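(* Let $G$ be a connected real Lie group and let $R\ge0$ and $R'\ge1$. Then for all $P,Q\in\widehat{\mathrm{Pol}}_{R,R'}(T^*G)$ the map $$\mathbb C\ni\hbar\mapsto P\star_{\mathrm{std}}Q\in\widehat{\mathrm{Pol}}_{R,R'}(T^*G)$$ is entire (i.e. a holomorphic map on $\mathbb C$ with values in this Fréchet space). Its Taylor series in $\hbar$ coincides with the formal standard-ordered star product: the $\hbar^k$-term is $\hbar^kC_k(P,Q)$, where $C_k$ is the bilinear operator given on factorizing tensors in $\mathrm{Pol}_{R,R'}(T^*G)$ by the coefficient of $\hbar^k$ in the explicit formula for $\star_{\mathrm{std}}$ and extended continuously to the completion.
   Context: All functions are complex-valued. $G$ is a connected real Lie group of dimension $n$ with Lie algebra $\mathfrak g$, unit $\mathrm e$ and fixed basis $(e_1,\dots,e_n)$ of $\mathfrak g$; for $\xi\in\mathfrak g$, $X_\xi$ is the left-invariant vector field with $X_\xi(\mathrm e)=\xi$, and $X_i=X_{e_i}$. For $\alpha\in\{1,\dots,n\}^k$ put $\mathcal L_{X_\alpha}=\mathcal L_{X_{\alpha_1}}\cdots\mathcal L_{X_{\alpha_k}}$. Set $$q_{R,c}(\phi)=\sum_{k\ge0}k!^{R-1}c^k\sum_{\alpha\in\{1,\dots,n\}^k}|(\mathcal L_{X_\alpha}\phi)(\mathrm e)|,$$ and $\mathscr E_R(G)=\{\phi\in C^\omega(G):q_{R,c}(\phi)<\infty\ \forall c\ge0\}$ ($C^\omega$ = real-analytic), topologized by all $q_{R,c}$. $\mathrm{Sym}_{R'}(\mathfrak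 g)$ is the (complexified) symmetric algebra, with product $\vee$, topologized by $p_{R',c}(v)=\sum_{k}k!^{R'}c^k\,p^k(v_k)$, $c\ge0$, where $v=\sum_kv_k$ with $v_k\in\mathrm{Sym}^k(\mathfrak g)$, $p$ is the $\ell^1$-norm on $\mathfrak g$ for the chosen basis and $p^k$ its $k$-fold projective tensor power on $\mathrm{Sym}^k(\mathfrak g)\subseteq\mathfrak g^{\otimes k}$. $\mathrm{Pol}_{R,R'}(T^*G)=\mathscr E_R(G)\otimes\mathrm{Sym}_{R'}(\mathfrak g)$ carries the projective tensor product topology, and $\widehat{\mathrm{Pol}}_{R,R'}(T^*G)$ is its completion. Star products, for $\hbar\in\mathbb C$ and $z=\hbar/\mathrm i$: the Gutt star product $\star_{\mathfrak g}$ on $\mathrm{Sym}^\bullet(\mathfrak g)$ is, for $z\neq0$, $\xi\star_{\mathfrak g}\eta=\mathfrak q_z^{-1}(\mathfrak q_z(\xi)\mathfrak q_z(\eta))$, where $\mathfrak q_z\colon\mathrm{Sym}^\bullet(\mathfrak g)\to\mathrm U_{\mathbb C}(\mathfrak g)$ is the linear isomorphism onto the complexified universal enveloping algebra with $\mathfrak q_z(\xi_1\vee\dots\vee\xi_k)=\frac{z^k}{k!}\sum_{\sigma\in S_k}\xi_{\sigma(1)}\cdots\xi_{\sigma(k)}$; the result is polynomial in $z$ (hence in $\hbar$) and equals $\xi\vee\eta$ at $z=0$. The explicit formula for the standard-ordered star product is $$(\phi\otimes\xi_1\vee\dots\vee\xi_k)\star_{\mathrm{std}}(\psi\otimes\eta)=\sum_{p=0}^k\Bigl(\frac{\hbar}{\mathrm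 i}\Bigr)^p\frac1{p!\,(k-p)!}\sum_{\sigma\in S_k}\bigl(\phi\cdot\mathcal L_{X_{\xi_{\sigma(1)}}}\cdots\mathcal L_{X_{\xi_{\sigma(p)}}}\psi\bigr)\otimes\bigl((\xi_{\sigma(p+1)}\vee\dots\vee\xi_{\sigma(k)})\star_{\mathfrak g}\eta\bigr)$$ for $\phi,\psi\in\mathscr E_R(G)$, $\xi_i\in\mathfrak g$, $\eta\in\mathrm{Sym}^\bullet(\mathfrak g)$; for $R\ge0$, $R'\ge1$ and each $\hbar\in\mathbb C$ it is continuous on $\mathrm{Pol}_{R,R'}(T^*G)$, and $\star_{\mathrm{std}}$ on $\widehat{\mathrm{Pol}}_{R,R'}(T^*G)$ denotes its continuous bilinear extension. *)

(* Defs.v *)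
From HB Require Import structures.
From mathcomp Require Import all_boot all_order all_algebra all_fingroup.
From mathcomp Require Import complex.
From mathcomp Require Import all_classical all_reals all_analysis.
From mathcomp Require mpoly.
(* The notations of mpoly clash with those of mathcomp-analysis. *)
Import -(notations) mpoly.

Set Implicit Arguments.
Unset Strict Implicit.
Unset Printing Implicit Defensive.

Import Order.TTheory GRing.Theory Num.Theory.
Import numFieldNormedType.Exports.

Local Open Scope classical_set_scope.
Local Open Scope ring_scope.
Local Open Scope complex_scope.

(** * Smooth and real-analytic functions on open subsets of R^m *)

Definition partials (R : realType) (m : nat) (s : seq 'I_m)
    (f : 'rV[R]_m -> R) : 'rV[R]_m -> R :=
  foldr (fun j h x => derive h x (delta_mx 0 j)) f s.

Definition smooth_on (R : realType) (m : nat) (U : set 'rV[R]_m)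
    (f : 'rV[R]_m -> R) : Prop :=
  forall (s : seq 'I_m) (x : 'rV[R]_m), U x ->
    {for x, continuous (partials s f)} /\
    (forall j : 'I_m, derivable (partials s f) x (delta_mx 0 j)).

(* The degree-k part of the power series with coefficients a, at h. *)
Definition powser_part (R : realType) (m : nat) (a : ('I_m -> nat) -> R)
    (h : 'rV[R]_m) (k : nat) : R :=
  \sum_(al : {ffun 'I_m -> 'I_k.+1} | (\sum_j (al j : nat) == k)%N)
     a (fun j => al j : nat) * \prod_j h 0 j ^+ (al j : nat).

(* Around x, f is the sum of an absolutely convergent power series. *)
Definition analytic_at (R : realType) (m : nat) (f : 'rV[R]_m -> R)
    (x : 'rV[R]_m) : Prop :=
  exists (a : ('I_m -> nat) -> R) (rho : R), 0 < rho /\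
    forall h : 'rV[R]_m, (forall j, `|h 0 j| < rho) ->
      cvgn (series (powser_part (fun al => `|a al|) (map_mx Num.norm h))) /\
      series (powser_part a h) @ \oo --> f (x + h).

(** * Real Lie groups *)

#[short(type="topGroupType")]
HB.structure Definition TopGroup := {G of Topological G & monoid.Group G}.

Record chart (R : realType) (n : nat) (T : topologicalType) := Chart {
  cdom : set T ;
  cmap : T -> 'rV[R]_n ;
  cinv : 'rV[R]_n -> T ;
  cdom_open : open cdom ;
  cimg_open : open (cmap @` cdom) ;
  cmapK : forall x, cdom x -> cinv (cmap x) = x ;
  cmap_continuous : forall x, cdom x -> {for x, continuous cmap} ;
  cinv_continuous : forall y, (cmap @` cdom) y -> {for y, continuous cinv} }.

(* A is a real-analytic atlas for which the group operations are analytic.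
   Every C^oo Lie group carries exactly one such compatible analytic
   structure, which is the one C^omega(G) refers to.  Second countability is
   automatic for connected groups. *)
Definition lie_group_atlas (R : realType) (n : nat) (G : topGroupType)
    (A : set (chart R n G)) : Prop :=
  [/\ hausdorff_space G,
      continuous (fun p : G * G => (p.1 * p.2)%g) /\
        continuous (fun g : G => (g^-1)%g),
      (forall g : G, exists2 u, A u & cdom u g),
      (forall u v, A u -> A v -> forall (g : G) (j : 'I_n),
         cdom u g -> cdom v g ->
         analytic_at (fun y => cmap v (cinv u y) 0 j) (cmap u g)) &
      (forall u v w, A u -> A v -> A w -> forall (g h : G) (j : 'I_n),
         cdom u g -> cdom v h -> cdom w (g * h)%g ->
         analytic_at
           (fun y : 'rV[R]_(n + n) =>
              cmap w (cinv u (lsubmx y) * cinv v (rsubmx y))%g 0 j)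
           (row_mx (cmap u g) (cmap v h))) /\
      (forall u v, A u -> A v -> forall (g : G) (j : 'I_n),
         cdom u g -> cdom v (g^-1)%g ->
         analytic_at (fun y => cmap v (cinv u y)^-1%g 0 j) (cmap u g))].

(* The complexified symmetric algebra of the Lie algebra, as polynomials in the
   vectors of a fixed basis. *)
Notation symalg R n := (mpoly.mpoly n R[i]).

Section LieGroup.
Variables (R : realType) (n : nat) (G : topGroupType) (A : set (chart R n G)).
Local Notation C := (R[i]).
Local Notation Sym := (symalg R n).

Definition smooth (f : G -> R) : Prop :=
  forall u, A u -> smooth_on (cmap u @` cdom u) (fun y => f (cinv u y)).

Definition analytic (f : G -> R) : Prop :=
  forall u, A u -> forall g, cdom u g ->
    analytic_at (fun y => f (cinv u y)) (cmap u g).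

(* Vector fields are derivations of the algebra of smooth functions;
   the values of D on non-smooth functions are irrelevant. *)
Definition vector_field (D : (G -> R) -> (G -> R)) : Prop :=
  [/\ forall f, smooth f -> smooth (D f),
      forall (a : R) f h, smooth f -> smooth h ->
        D (fun g => a * f g + h g) = (fun g => a * D f g + D h g) &
      forall f h, smooth f -> smooth h ->
        D (fun g => f g * h g) = (fun g => D f g * h g + f g * D h g)].

Definition left_invariant (D : (G -> R) -> (G -> R)) : Prop :=
  forall (a : G) f, smooth f ->
    D (fun g => f (a * g)%g) = (fun g => D f (a * g)%g).

(* X_xi = \sum_i xi_i X_i, where X_i is the left-invariant field of the
   basis vector e_i *)
Definition field_of (X : 'I_n -> (G -> R) -> (G -> R)) (xi : 'rV[R]_n) :
    (G -> R) -> (G -> R) :=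
  fun f g => \sum_i xi 0 i * X i f g.

(* (X_1, ..., X_n) is a basis of the left-invariant vector fields, i.e. comes
   from a basis of the Lie algebra of G.  From here on an element of the Lie
   algebra is the row vector of its coordinates in that basis. *)
Definition left_invariant_basis (X : 'I_n -> (G -> R) -> (G -> R)) : Prop :=
  (forall i, vector_field (X i) /\ left_invariant (X i)) /\
  (forall D, vector_field D -> left_invariant D ->
     exists! xi : 'rV[R]_n, forall f, smooth f -> D f = field_of X xi f).

Variable X : 'I_n -> (G -> R) -> (G -> R).

(* zeta = [xi, eta] *)
Definition is_bracket (xi eta zeta : 'rV[R]_n) : Prop :=
  forall f, smooth f -> forall g,
    field_of X zeta f g =
    field_of X xi (field_of X eta f) g - field_of X eta (field_of X xi f) g.

(* Complex-linear extension of D to complex-valued functions. *)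
Definition lie_deriv (D : (G -> R) -> (G -> R)) (phi : G -> C) : G -> C :=
  fun g => D (fun x => complex.Re (phi x)) g +i*
           D (fun x => complex.Im (phi x)) g.

Definition lie_derivs (xis : seq 'rV[R]_n) (phi : G -> C) : G -> C :=
  foldr (fun xi psi => lie_deriv (field_of X xi) psi) phi xis.

(** ** The space E_r(G) *)

Definition qnorm (r c : R) (phi : G -> C) : \bar R :=
  (\sum_(0 <= k <oo)
     ((k`!%:R `^ (r - 1) * c ^+ k *
       \sum_(al : k.-tuple 'I_n)
          Normc.normc (foldr (fun i psi => lie_deriv (X i) psi) phi al 1%g))%:E))%E.

Definition entire_functions (r : R) : set (G -> C) :=
  [set phi | [/\ analytic (fun g => complex.Re (phi g)),
                 analytic (fun g => complex.Im (phi g)) &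
                 forall c : R, 0 <= c -> (qnorm r c phi < +oo)%E]].

(** ** The complexified symmetric algebra *)

Definition sym_of (xi : 'rV[R]_n) : Sym :=
  \sum_i (xi 0 i)%:C *: mpolyX C (mnm1 i).

(* The multiplicities of the e_i in e_{al_1} \/ ... \/ e_{al_k}. *)
Definition multiplicities (k : nat) (al : k.-tuple 'I_n) : multinom n :=
  Multinom [tuple count_mem i al | i < n].

(* The inclusion of Sym^k into the k-fold tensor power, the latter in
   coordinates w.r.t. the e_{al_1} (x) ... (x) e_{al_k}, for the convention
     x_1 \/ ... \/ x_k = 1/k! \sum_sigma x_{sigma 1} (x) ... (x) x_{sigma k}.
   The monomial with multiplicities m has k! / \prod_i m_i! distinct
   rearrangements, all with the same coefficient.  Only the component of v of
   degree k contributes. *)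
Definition sym_tensor (k : nat) (v : Sym) : {ffun k.-tuple 'I_n -> C} :=
  [ffun al => mcoeff (multiplicities al) v *
              (\prod_(i < n) (multiplicities al i)`!)%:R / k`!%:R].

Definition pure_tensor (k : nat) (x : 'I_k -> 'rV[C]_n) :
    {ffun k.-tuple 'I_n -> C} :=
  [ffun al => \prod_(j < k) x j 0 (tnth al j)].

(* The norm p on the complexified Lie algebra. *)
Definition l1norm (x : 'rV[C]_n) : R := \sum_i Normc.normc (x 0 i).

(* The projective tensor power of the l^1-norm, on the component of v of
   degree k; the scalars x.1 matter for k = 0 only. *)
Definition proj_norm (k : nat) (v : Sym) : R :=
  inf [set t : R | exists s : seq (C * ('I_k -> 'rV[C]_n)),
         sym_tensor k v = [ffun al => \sum_(x <- s) x.1 * pure_tensor x.2 al] /\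
         t = \sum_(x <- s) Normc.normc x.1 * \prod_(j < k) l1norm (x.2 j)].

(* All degrees occurring in v are < msize v. *)
Definition pnorm (r' c : R) (v : Sym) : R :=
  \sum_(k < mmeasure mdeg v) k`!%:R `^ r' * c ^+ k * proj_norm k v.

(** ** Polynomials on the cotangent bundle *)

(* The algebraic tensor product of E_r(G) with Sym is realized as the space
   spanned by the functions g |-> phi g *: v; since the elements of E_r(G) are
   functions, the canonical map from the tensor product is injective. *)
Definition tens (phi : G -> C) (v : Sym) : G -> Sym := fun g => phi g *: v.

Definition represents (r : R) (s : seq ((G -> C) * Sym)) (P : G -> Sym) : Prop :=
  (forall x, x \in s -> entire_functions r x.1) /\
  P = (fun g => \sum_(x <- s) tens x.1 x.2 g).

Definition Pol (r : R) : set (G -> Sym) :=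
  [set P | exists s, represents r s P].

Definition pol_norm (r r' c c' : R) (P : G -> Sym) : R :=
  inf [set t : R | exists s, represents r s P /\
         t = \sum_(x <- s) fine (qnorm r c x.1) * pnorm r' c' x.2].

(* Cauchy filters for the additive structure: the uniform structure of a
   tvsType need not be the translation-invariant one. *)
Definition tvs_cauchy (H : tvsType C) (F : set_system H) : Prop :=
  forall U : set H, nbhs 0 U ->
    exists2 B : set H, F B & forall x y, B x -> B y -> U (x - y).

(* (H, j) is the completion of Pol for the projective tensor topology: H is
   complete Hausdorff, j (only relevant on Pol) is linear with dense image, and
   the topology of Pol is induced by j.  The seminorms pol_norm are increasing
   in c and c', so their balls form a basis of neighborhoods of 0. *)
Definition is_completion (r r' : R) (H : tvsType C) (j : (G -> Sym) -> H) : Prop :=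
  [/\ hausdorff_space H /\
        (forall F : set_system H, ProperFilter F -> tvs_cauchy F ->
           exists l : H, F --> l),
      forall (a : C) P Q, Pol r P -> Pol r Q ->
        j (fun g => a *: P g + Q g) = a *: j P + j Q,
      forall U : set H, nbhs 0 U ->
        exists c c' e : R, [/\ 0 <= c, 0 <= c', 0 < e &
          forall P, Pol r P -> pol_norm r r' c c' P < e -> U (j P)],
      forall c c' e : R, 0 <= c -> 0 <= c' -> 0 < e ->
        exists2 U : set H, nbhs 0 U &
          forall P, Pol r P -> U (j P) -> pol_norm r r' c c' P < e &
      dense (j @` Pol r)].

(** ** The universal enveloping algebra and the Gutt star product *)

Definition lin_ext (U : lmodType C) (u : 'I_n -> U) (xi : 'rV[R]_n) : U :=
  \sum_i (xi 0 i)%:C *: u i.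

Definition bracket_relations (U : algType C) (u : 'I_n -> U) : Prop :=
  forall xi eta zeta, is_bracket xi eta zeta ->
    lin_ext u xi * lin_ext u eta - lin_ext u eta * lin_ext u xi =
    lin_ext u zeta.

(* U, with u i the image of e_i, is the complexified universal enveloping
   algebra. *)
Definition is_enveloping (U : algType C) (u : 'I_n -> U) : Prop :=
  bracket_relations u /\
  forall (B : algType C) (w : 'I_n -> B), bracket_relations w ->
    exists F : {lrmorphism U -> B}, (forall i, F (u i) = w i) /\
      forall F' : {lrmorphism U -> B}, (forall i, F' (u i) = w i) -> F' =1 F.

(* The linear maps q_z, which for z != 0 are isomorphisms. *)
Definition is_quantization (U : algType C) (u : 'I_n -> U)
    (q : C -> {linear Sym -> U}) : Prop :=
  (forall z, z != 0 -> bijective (q z)) /\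
  (forall z (k : nat) (xi : 'I_k -> 'rV[R]_n),
     q z (\prod_(i < k) sym_of (xi i)) =
     (z ^+ k / k`!%:R) *:
       \sum_(sg : 'S_k) \prod_(i < k) lin_ext u (xi (sg i))).

(* gutt z is the Gutt star product with parameter z = hbar / i. *)
Definition is_gutt (U : algType C) (q : C -> {linear Sym -> U})
    (gutt : C -> Sym -> Sym -> Sym) : Prop :=
  (forall z v w, z != 0 -> q z (gutt z v w) = q z v * q z w) /\
  (forall v w, gutt 0 v w = v * w).

(** ** The standard-ordered star product *)

Variable gutt : C -> Sym -> Sym -> Sym.

(* The explicit formula for
     (phi (x) xi_1 \/ ... \/ xi_k) star_std (psi (x) eta);
   map xi (codom sg) lists xi_{sg 1}, ..., xi_{sg k}. *)
Definition std_formula (phi : G -> C) (k : nat) (xi : 'I_k -> 'rV[R]_n)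
    (psi : G -> C) (eta : Sym) (hbar : C) : G -> Sym :=
  fun g => \sum_(p < k.+1) \sum_(sg : 'S_k)
    ((hbar / 'i) ^+ p / (p`! * (k - p)`!)%:R) *:
    tens (fun x => phi x * lie_derivs (take p (map xi (codom sg))) psi x)
         (gutt (hbar / 'i)
            (\prod_(x <- drop p (map xi (codom sg))) sym_of x) eta) g.

Definition continuous_bilinear (H : tvsType C) (S : H -> H -> H) : Prop :=
  [/\ forall P, linear (S P), forall Q, linear (S^~ Q) &
      continuous (fun PQ : H * H => S PQ.1 PQ.2)].

(* S is the continuous bilinear extension to H of the bilinear operator on Pol
   given by the formula B on factorizing tensors. *)
Definition is_extension (r : R) (H : tvsType C) (j : (G -> Sym) -> H)
    (B : (G -> C) -> forall k : nat, ('I_k -> 'rV[R]_n) -> (G -> C) -> Sym ->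
         (G -> Sym))
    (S : H -> H -> H) : Prop :=
  continuous_bilinear S /\
  forall (phi psi : G -> C) (k : nat) (xi : 'I_k -> 'rV[R]_n) (eta : Sym),
    entire_functions r phi -> entire_functions r psi ->
    Pol r (B phi k xi psi eta) /\
    S (j (tens phi (\prod_(i < k) sym_of (xi i)))) (j (tens psi eta)) =
    j (B phi k xi psi eta).

Definition is_std_star (r : R) (H : tvsType C) (j : (G -> Sym) -> H)
    (hbar : C) (S : H -> H -> H) : Prop :=
  is_extension r j
    (fun phi k xi psi eta => std_formula phi xi psi eta hbar) S.

(* F is a polynomial function of hbar with coefficients a k. *)
Definition has_coefficients (F : C -> G -> Sym) (a : nat -> G -> Sym) : Prop :=
  exists N : nat, (forall k, (N <= k)%N -> a k = (fun=> 0)) /\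
    forall hbar g, F hbar g = \sum_(k < N) hbar ^+ k *: a k g.

End LieGroup.

(** * Holomorphic functions with values in a topological vector space *)

Definition is_cderive (R : realType) (H : tvsType R[i]) (f : R[i] -> H)
    (z : R[i]) (l : H) : Prop :=
  (fun h : R[i]^o => h^-1 *: (f (h + z) - f z)) @ 0^' --> l.

Definition entire (R : realType) (H : tvsType R[i]) (f : R[i] -> H) : Prop :=
  forall z, exists l, is_cderive f z l.

(* a k is the k-th Taylor coefficient of f at 0: d k is the k-th derivative. *)
Definition taylor_coefficients (R : realType) (H : tvsType R[i])
    (f : R[i] -> H) (a : nat -> H) : Prop :=
  exists d : nat -> R[i] -> H,
    [/\ d 0%N = f,
        forall k z, is_cderive (d k) z (d k.+1 z) &
        forall k, a k = (k`!%:R)^-1 *: d k 0].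

(* Main.v *)
Require Import Defs.
From HB Require Import structures.
From mathcomp Require Import all_boot all_order all_algebra all_fingroup.
From mathcomp Require Import complex.
From mathcomp Require Import all_classical all_reals all_analysis.
From mathcomp Require mpoly.
Import -(notations) mpoly.
From mathcomp Require Import ring lra zify.
From mathcomp Require Import cyclic separable cyclotomic.
Set Implicit Arguments.
Unset Strict Implicit.
Unset Printing Implicit Defensive.
Import Order.TTheory GRing.Theory Num.Theory.
Import numFieldNormedType.Exports.
Local Open Scope classical_set_scope.
Local Open Scope ring_scope.
Local Open Scope complex_scope.

(* Only the homogeneity of the star product is used, no estimate for the
   explicit formula.  Let delta_a multiply the polynomials of degree d by a^d.
   Then, for z <> 0,
     P *_z Q = delta_{1/z} (delta_z P *_1 delta_z Q),
   and the seminorms of delta_a P are those of P with the weight c' replaced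
   by |a| c'.  So the continuity of *_1 alone bounds P *_z Q uniformly on every
   circle |z| = rho, first for polynomials and then, by density, on the whole
   completion.  Averaging over roots of unity recovers the coefficients C_m,
   with the Cauchy estimates rho^m |C_m(P, Q)| <= K_rho |P| |Q| for every rho;
   hence the power series with these coefficients is entire and represents the
   star product, which for polynomials P and Q is a polynomial in z.
   That last fact reduces to the Gutt star product, where it is the statement
   that in the enveloping algebra a monomial equals its symmetrization up to
   terms of lower degree. *)

(** Continuity of the star product is given for each hbar separately, which yields no bound that is
    locally uniform in hbar, as Cauchy estimates require. Homogeneity supplies it, because the
    family of all weights c' is stable under c' -> |a| c'. The dilations act on polynomials only,
    where identities can be checked on tensors of monomials; what passes to the completion is the
    resulting inequality, not delta_a itself. Since the completion is abstract, the seminorms must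
    first be carried over to it, as infima over closures of balls. An average over N-th roots of
    unity is a Cauchy integral that is exact as soon as N exceeds the degree. For polynomials these
    averages are therefore eventually constant in N; the uniform bound on the unit circle then makes
    them Cauchy for all P and Q, and their limit defines C_m(P, Q) on the whole completion. In the
    overview z may be read as hbar, the Gutt product having then the parameter hbar / i. *)

Local Notation normc := Normc.normc.

(** * Brackets of left-invariant vector fields *)

Section SmoothClosure.
Variables (R : realType) (m : nat) (U : set 'rV[R]_m).
Hypothesis oU : open U.
Implicit Types (F f h : 'rV[R]_m -> R).

(** By induction the iterated partials of [F] agree on [U] with members of [K]; since [U] is open,
    agreement on [U] is preserved by derivatives. This spares any formula for the higher partials of
    a product. *)
Lemma smooth_on_coinduction (K : set ('rV[R]_m -> R)) :
  (forall F, K F -> forall x, U x -> {for x, continuous F}) ->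
  (forall F j, K F -> exists2 F', K F' &
     forall x, U x -> is_derive x (delta_mx 0 j) F (F' x)) ->
  forall F, K F -> smooth_on U F.
Proof.
move=> Kc Kd F KF.
have near_eq f h x : U x -> {in U, f =1 h} -> \forall y \near x, f y = h y.
  move=> Ux fh; have := open_nbhs_nbhs (conj oU Ux).
  by apply: filterS => y Uy; apply: fh; rewrite inE.
have part s : exists2 F', K F' & {in U, partials s F =1 F'}.
  elim: s => [|j s [F1 KF1 E1]]; first by exists F.
  have [F2 KF2 E2] := Kd F1 j KF1; exists F2 => // x; rewrite inE => Ux /=.
  have [_ <-] := E2 x Ux; apply: near_eq_derive; exact: near_eq.
move=> s x Ux; have [F1 KF1 E1] := part s; split=> [|j].
  change (partials s F @ x --> partials s F x); rewrite E1 ?inE //.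
  have e : \forall y \near x, F1 y = partials s F y.
    by apply: near_eq => // y yU; rewrite E1.
  exact: cvg_trans (near_eq_cvg e) (Kc _ KF1 x Ux).
have [F2 KF2 E2] := Kd F1 j KF1; have [d _] := E2 x Ux.
by apply: near_eq_derivable d; apply: near_eq => // y yU; rewrite E1.
Qed.

Lemma smooth_on_linear (a : R) f h :
  smooth_on U f -> smooth_on U h -> smooth_on U (fun x => a * f x + h x).
Proof.
move=> sf sh.
pose K := [set F | exists s, F = (fun x => a * partials s f x + partials s h x)].
apply: (@smooth_on_coinduction K); last by exists [::].
  move=> _ [s ->] x Ux; have [cf _] := sf s x Ux; have [ch _] := sh s x Ux.
  have ca : {for x, continuous (cst a : 'rV[R]_m -> R)} by apply: cst_continuous.
  exact: (continuousD (continuousM ca cf) ch).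
move=> _ j [s ->].
exists (fun x => a * partials (j :: s) f x + partials (j :: s) h x) => [|x Ux].
  by exists (j :: s).
have [_ /(_ j)/derivableP df] := sf s x Ux.
have [_ /(_ j)/derivableP dh] := sh s x Ux.
exact: (is_deriveD (is_deriveZ a df) dh).
Qed.

Lemma smooth_onM f h :
  smooth_on U f -> smooth_on U h -> smooth_on U (fun x => f x * h x).
Proof.
move=> sf sh.
(* By the Leibniz rule, finite sums of products of partials form a class closed under
   differentiation. *)
pose S (L : seq (seq 'I_m * seq 'I_m)) x :=
  \sum_(p <- L) partials p.1 f x * partials p.2 h x.
have SE s t L : S ((s, t) :: L) = (partials s f * partials t h) + S L.
  by apply/funext => x; rewrite /S big_cons.
have S0 : S [::] = cst 0 by apply/funext => x; rewrite /S big_nil.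
apply: (@smooth_on_coinduction [set F | exists L, F = S L]).
- move=> _ [L ->] x Ux; elim: L => [|[s t] L IH].
    by rewrite S0; apply: cst_continuous.
  have [cf _] := sf s x Ux; have [ch _] := sh t x Ux.
  by rewrite SE; exact: (continuousD (continuousM cf ch) IH).
- move=> _ j [L ->].
  exists (S (flatten [seq [:: (p.1, j :: p.2); (j :: p.1, p.2)] | p <- L])) => [|x Ux].
    by eexists.
  elim: L => [|[s t] L IH]; first by rewrite /= S0; exact: is_derive_cst.
  have [_ /(_ j)/derivableP df] := sf s x Ux.
  have [_ /(_ j)/derivableP dh] := sh t x Ux.
  rewrite /= !SE addrA; have := is_deriveD (is_deriveM df dh) IH.
  by rewrite /GRing.scale /= [partials t h x * _]mulrC.
by exists [:: ([::], [::])]; apply/funext => x; rewrite /S big_seq1.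
Qed.

End SmoothClosure.

(** * Commutators of left-invariant fields *)

Section Brackets.
Variables (R : realType) (n : nat) (G : topGroupType) (A : set (chart R n G)).
Implicit Types (f h : G -> R) (D : (G -> R) -> (G -> R)).

Lemma smooth_linear (a : R) f h :
  smooth A f -> smooth A h -> smooth A (fun g => a * f g + h g).
Proof.
move=> sf sh v Av; apply: smooth_on_linear; [exact: cimg_open|exact: sf|exact: sh].
Qed.

Lemma smoothM f h : smooth A f -> smooth A h -> smooth A (fun g => f g * h g).
Proof.
move=> sf sh v Av; apply: smooth_onM; [exact: cimg_open|exact: sf|exact: sh].
Qed.

Definition field_bracket D D' f g : R := D (D' f) g - D' (D f) g.

Lemma vector_field_bracket D D' : vector_field A D -> vector_field A D' ->
  vector_field A (field_bracket D D').
Proof.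
move=> [Ds Dl Dm] [Ds' Dl' Dm']; split.
- move=> f sf; rewrite /field_bracket.
  rewrite (_ : (fun g => _) = fun g => (-1) * D' (D f) g + D (D' f) g).
    by apply: smooth_linear; auto.
  by apply/funext => g; rewrite mulN1r addrC.
- move=> a f h sf sh; rewrite /field_bracket; apply/funext => g.
  rewrite (Dl' a f h sf sh) (Dl a f h sf sh).
  rewrite (Dl _ _ _ (Ds' _ sf) (Ds' _ sh)) (Dl' _ _ _ (Ds _ sf) (Ds _ sh)).
  by rewrite mulrBr opprD addrACA.
- move=> f h sf sh; rewrite /field_bracket; apply/funext => g.
  have P1 E f1 f2 h1 h2 : (forall (a : R) f h, smooth A f -> smooth A h ->
        E (fun g => a * f g + h g) = (fun g => a * E f g + E h g)) ->
      smooth A f1 -> smooth A f2 -> smooth A h1 -> smooth A h2 ->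
      E (fun g => f1 g * h1 g + f2 g * h2 g) g =
      E (fun g => f1 g * h1 g) g + E (fun g => f2 g * h2 g) g.
    move=> El s1 s2 t1 t2; have := El 1 _ _ (smoothM s1 t1) (smoothM s2 t2).
    move=> /(congr1 (fun F => F g)); rewrite mul1r => <-; congr (E _ g).
    by apply/funext => y; rewrite mul1r.
  have [[[sDf sDh] sDf'] sDh'] := (Ds _ sf, Ds _ sh, Ds' _ sf, Ds' _ sh).
  rewrite (Dm' f h) // (Dm f h) // (P1 D) // (P1 D') //.
  rewrite (Dm (D' f)) // (Dm f) // (Dm' (D f)) // (Dm' f) //.
  by ring.
Qed.

Lemma left_invariant_bracket D D' : vector_field A D -> vector_field A D' ->
  left_invariant A D -> left_invariant A D' ->
  left_invariant A (field_bracket D D').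
Proof.
move=> [Ds _ _] [Ds' _ _] Dl Dl' a f sf; apply/funext => g.
by rewrite /field_bracket (Dl' a f) // (Dl a f) // (Dl a _ (Ds' _ sf)) (Dl' a _ (Ds _ sf)).
Qed.

(** [is_bracket] only tests a candidate. A bracket exists because the commutator is again a
    left-invariant derivation, hence a combination of the basis fields. *)
Lemma basis_brackets X : left_invariant_basis A X ->
  forall i l, exists zeta, is_bracket A X (delta_mx 0 i) (delta_mx 0 l) zeta.
Proof.
move=> [XP Xb] i l; have [[vi li] [vl ll]] := (XP i, XP l).
have [zeta [hz _]] := Xb _ (vector_field_bracket vi vl) (left_invariant_bracket vi vl li ll).
have fE k : field_of X (delta_mx 0 k) = X k.
  apply/funext => f; apply/funext => g; rewrite /field_of (bigD1 k) //=.
  rewrite mxE !eqxx mul1r big1 ?addr0 // => k' /negPf kk.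
  by rewrite mxE eqxx kk mul0r.
by exists zeta => f sf g; rewrite !fE -hz.
Qed.

End Brackets.

(** * Polynomiality and homogeneity of the Gutt star product *)

Section Dilation.
Variables (n : nat) (K : comNzRingType).
Local Notation Sym := (mpoly n K).

Definition dilate (a : K) (v : Sym) : Sym :=
  \sum_(m <- msupp v) (a ^+ mdeg m * mcoeff m v) *: mpolyX K m.

Lemma mcoeff_dilate a v m : mcoeff m (dilate a v) = a ^+ mdeg m * mcoeff m v.
Proof.
rewrite /dilate raddf_sum /=.
have [mv|mv] := boolP (m \in msupp v).
  rewrite (bigD1_seq m) ?msupp_uniq //= mcoeffZ mcoeffX eqxx mulr1.
  rewrite big1 ?addr0 // => i /negPf im.
  by rewrite mcoeffZ mcoeffX im mulr0.
rewrite (memN_msupp_eq0 mv) mulr0 big_seq big1 // => i iv.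
rewrite mcoeffZ mcoeffX; case: eqP => [im|]; last by rewrite mulr0.
by rewrite -im iv in mv.
Qed.

Lemma dilate_is_linear a : linear (dilate a).
Proof.
move=> b v w; apply/mpolyP => m.
by rewrite mcoeff_dilate !(mcoeffD, mcoeffZ) !mcoeff_dilate mulrDr mulrCA.
Qed.

HB.instance Definition _ a :=
  GRing.isLinear.Build K Sym Sym *:%R (dilate a) (dilate_is_linear a).

Lemma dilateK a b v : a * b = 1 -> dilate a (dilate b v) = v.
Proof.
move=> ab1; apply/mpolyP => m.
by rewrite !mcoeff_dilate mulrA -exprMn ab1 expr1n mul1r.
Qed.

Lemma dilate_homog a d v : v \is ishomog1 d mdeg -> dilate a v = a ^+ d *: v.
Proof.
move=> /dhomogP hv; apply/mpolyP => m; rewrite mcoeff_dilate mcoeffZ.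
have [/hv ->//|mv] := boolP (m \in msupp v).
by rewrite (memN_msupp_eq0 mv) !mulr0.
Qed.

Lemma msize_dilate a v : (mmeasure mdeg (dilate a v) <= mmeasure mdeg v)%N.
Proof.
rewrite [X in (X <= _)%N]mmeasureE; apply/bigmax_leqP_seq => m mv _.
apply: msize_mdeg_lt; rewrite mcoeff_msupp; apply: contraTneq mv => v0.
by rewrite mcoeff_msupp mcoeff_dilate v0 mulr0 eqxx.
Qed.

(** Monomials are indexed by words, so that they can be compared with ordered products in the
    enveloping algebra; permuted words give the same monomial. *)
Definition smon (s : seq 'I_n) : Sym := \prod_(i <- s) mpolyX K (mnm1 i).

Lemma smon_homog s : smon s \is ishomog1 (size s) mdeg.
Proof.
rewrite /smon; elim: s => [|i s IH]; first by rewrite big_nil dhomog1.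
by rewrite big_cons -[size _]add1n dhomogM // dhomogX; apply/eqP/mdeg1.
Qed.

Lemma smon_cat s t : smon (s ++ t) = smon s * smon t.
Proof. exact: big_cat. Qed.

Lemma mpolyX_smon (m : multinom n) : exists2 s, mpolyX K m = smon s & size s = mdeg m.
Proof.
exists (flatten [seq nseq (m i) i | i <- enum 'I_n]).
  rewrite mpolyXE_id /smon big_flatten big_map big_enum /=.
  apply: eq_bigr => i _.
  by elim: (m i) => [|k IH]; rewrite ?big_nil // exprS IH big_cons.
rewrite size_flatten /shape -map_comp mdegE sumnE big_map big_enum /=.
by apply: eq_bigr => i _; rewrite size_nseq.
Qed.

Lemma smon_ind (Z : Sym -> Prop) :
  Z 0 -> (forall a v w, Z v -> Z w -> Z (a *: v + w)) ->
  (forall s, Z (smon s)) -> forall v, Z v.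
Proof.
move=> Z0 ZD Zs v; rewrite (mpolyE v); elim: (msupp v) => [|m s IH].
  by rewrite big_nil.
by rewrite big_cons; apply: ZD => //; have [t -> _] := mpolyX_smon m.
Qed.

End Dilation.

Arguments smon {n K}.

(** * Polynomial functions with values in a module *)

Section PolynomialMaps.
Variables (K : comNzRingType) (V : lmodType K).

(** The bound [N] is explicit because it decides how many roots of unity suffice to recover the
    coefficients. *)
Definition polynomial_with (F : K -> V) (a : nat -> V) (N : nat) : Prop :=
  (forall m, (N <= m)%N -> a m = 0) /\
  forall z, F z = \sum_(m < N) z ^+ m *: a m.

Definition polynomial_map (F : K -> V) : Prop :=
  exists a N, polynomial_with F a N.

Lemma polynomial_with_widen F a N N' :
  (N <= N')%N -> polynomial_with F a N -> polynomial_with F a N'.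
Proof.
move=> NN' [aN FE]; split=> [m /(leq_trans NN')/aN //|z].
rewrite FE (big_ord_widen _ (fun m : nat => z ^+ m *: a m) NN') big_mkcond /=.
by apply: eq_bigr => m _; case: ltnP => // /aN ->; rewrite scaler0.
Qed.

Lemma polynomial_monomial p (v : V) : polynomial_map (fun z => z ^+ p *: v).
Proof.
exists (fun m => if m == p then v else 0), p.+1; split=> [m|z].
  by move=> pm; case: eqP pm => // ->; rewrite ltnn.
rewrite big_ord_recr /= eqxx big1 ?add0r // => i _.
by rewrite (ltn_eqF (ltn_ord i)) scaler0.
Qed.

Lemma polynomialD F F' : polynomial_map F -> polynomial_map F' ->
  polynomial_map (fun z => F z + F' z).
Proof.
move=> [a [N aN]] [b [M bM]].
have [a0 FE] := polynomial_with_widen (leq_maxl N M) aN.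
have [b0 FE'] := polynomial_with_widen (leq_maxr N M) bM.
exists (fun m => a m + b m), (maxn N M); split=> [m h|z].
  by rewrite a0 // b0 // addr0.
by rewrite FE FE' -big_split; apply: eq_bigr => m _; rewrite scalerDr.
Qed.

Lemma polynomial0 : polynomial_map (fun=> 0 : V).
Proof. by exists (fun=> 0), 0%N; split=> // z; rewrite big_ord0. Qed.

Lemma eq_polynomial F F' : F =1 F' -> polynomial_map F -> polynomial_map F'.
Proof. by move=> FF' [a [N [? FE]]]; exists a, N; split=> // z; rewrite -FF'. Qed.

Lemma polynomial_sum (I : Type) (r : seq I) (F : I -> K -> V) :
  (forall i, polynomial_map (F i)) -> polynomial_map (fun z => \sum_(i <- r) F i z).
Proof.
move=> FP; elim: r => [|i r IH].
  by apply: eq_polynomial polynomial0 => z; rewrite big_nil.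
by apply: eq_polynomial (polynomialD (FP i) IH) => z; rewrite big_cons.
Qed.

Lemma polynomial_powZ p (a : K) F :
  polynomial_map F -> polynomial_map (fun z => (a * z ^+ p) *: F z).
Proof.
move=> [b [N [_ FE]]].
apply: (@eq_polynomial (fun z => \sum_(m < N) z ^+ (p + m) *: (a *: b m))).
  move=> z; rewrite FE scaler_sumr; apply: eq_bigr => m _.
  by rewrite !scalerA exprD mulrC mulrA.
by apply: polynomial_sum => m; exact: polynomial_monomial.
Qed.

Lemma polynomial_compZ (c : K) F :
  polynomial_map F -> polynomial_map (fun z => F (c * z)).
Proof.
move=> [b [N [_ FE]]].
apply: (@eq_polynomial (fun z => \sum_(m < N) z ^+ m *: (c ^+ m *: b m))).
  by move=> z; rewrite FE; apply: eq_bigr => m _; rewrite scalerA mulrC exprMn.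
by apply: polynomial_sum => m; exact: polynomial_monomial.
Qed.

End PolynomialMaps.

(** * Symmetrization and the Gutt star product *)

Section Gutt.
Variables (R : realType) (n : nat) (U : algType R[i]) (u : 'I_n -> U).
Variable q : R[i] -> {linear symalg R n -> U}.
Variable gutt : R[i] -> symalg R n -> symalg R n -> symalg R n.
Hypothesis qP : is_quantization u q.
Hypothesis guttP : is_gutt q gutt.
Hypothesis bracket : forall i l, exists zeta : 'rV[R]_n,
  u i * u l - u l * u i = lin_ext u zeta.
Local Notation C := R[i].
Local Notation Sym := (symalg R n).

Lemma sym_of_delta i : sym_of (delta_mx 0 i : 'rV[R]_n) = mpolyX C (mnm1 i).
Proof.
rewrite /sym_of (bigD1 i) //= mxE !eqxx scale1r big1 ?addr0 // => k ki.
by rewrite mxE eqxx /= (negPf ki) scale0r.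
Qed.

Lemma smon_sym_of (s : seq 'I_n) : smon s =
  \prod_(i < size s) sym_of (delta_mx 0 (tnth (in_tuple s) i) : 'rV[R]_n).
Proof.
under eq_bigr do rewrite sym_of_delta.
by rewrite /smon (big_tnth _ _ s).
Qed.

Lemma lin_ext_delta i : lin_ext u (delta_mx 0 i) = u i.
Proof.
rewrite /lin_ext (bigD1 i) //= mxE !eqxx scale1r big1 ?addr0 // => k ki.
by rewrite mxE eqxx /= (negPf ki) scale0r.
Qed.

Lemma sym_of_homog (xi : 'rV[R]_n) : sym_of xi \is ishomog1 1 mdeg.
Proof.
rewrite /sym_of rpred_sum // => i _; rewrite rpredZ // dhomogX.
exact/eqP/mdeg1.
Qed.

Lemma prod_sym_of_homog (s : seq 'rV[R]_n) :
  \prod_(x <- s) sym_of x \is ishomog1 (size s) mdeg.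
Proof.
elim: s => [|x s IH]; first by rewrite big_nil dhomog1.
by rewrite big_cons -[size _]add1n dhomogM // sym_of_homog.
Qed.

Lemma index_enumE (T : finType) : index_enum T = enum T.
Proof. by rewrite enumT [index_enum _]unlock. Qed.

Definition umon (s : seq 'I_n) : U := \prod_(i <- s) u i.

Lemma umon_cat s t : umon (s ++ t) = umon s * umon t.
Proof. exact: big_cat. Qed.

(** [r] lists one rearrangement of [s] per permutation, repetitions included, so its size is the
    factorial in [q] and the symmetrization becomes a plain average of words. *)
Lemma q_smon z (s : seq 'I_n) : exists r : seq (seq 'I_n),
  [/\ all (perm_eq s) r, (0 < size r)%N &
      q z (smon s) = (z ^+ size s / (size r)%:R) *: \sum_(t <- r) umon t].
Proof.
pose f (sg : 'S_(size s)) := [seq tnth (in_tuple s) (sg i) | i <- enum 'I_(size s)].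
exists [seq f sg | sg <- enum 'S_(size s)]; split.
- apply/allP => t /mapP[sg _ ->].
  suff: perm_eq (map (tnth (in_tuple s)) (enum 'I_(size s)))
      (map (tnth (in_tuple s)) (map sg (enum 'I_(size s)))).
    by rewrite map_tnth_enum -map_comp.
  rewrite perm_map //.
  rewrite uniq_perm ?enum_uniq //; first by rewrite map_inj_uniq ?enum_uniq //; exact: perm_inj.
  move=> i; rewrite mem_enum; apply/esym/mapP; exists (sg^-1%g i); first by rewrite mem_enum.
  by rewrite permKV.
- by rewrite size_map -cardE card_Sn fact_gt0.
rewrite smon_sym_of; case: qP => _ ->; rewrite size_map -cardE card_Sn; congr (_ *: _).
rewrite big_map -index_enumE; apply: eq_bigr => sg _.
rewrite /umon /f big_map -index_enumE; apply: eq_bigr => i _.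
by rewrite lin_ext_delta.
Qed.

Lemma msize_smon (s : seq 'I_n) : (mmeasure mdeg (smon s : Sym) <= (size s).+1)%N.
Proof.
rewrite mmeasureE; apply/bigmax_leqP_seq => m mv _.
by rewrite ltnS (dhomog_mf (smon_homog _ s) mv).
Qed.

(** The filtration of the enveloping algebra, seen through symmetrization. As [mmeasure mdeg] is the
    degree plus one, [fil d] is the image of the polynomials of degree strictly below [d]. *)
Definition fil (d : nat) (y : U) : Prop :=
  exists2 v : Sym, (mmeasure mdeg v <= d)%N & y = q 1 v.

Lemma fil0 d : fil d 0.
Proof. by exists 0; rewrite ?mmeasure0 ?raddf0. Qed.

Lemma filZ d a x : fil d x -> fil d (a *: x).
Proof.
move=> [v vd ->]; exists (a *: v); last by rewrite linearZ.
exact: leq_trans (mmeasureZ_le _ _ _) vd.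
Qed.

Lemma filD d x y : fil d x -> fil d y -> fil d (x + y).
Proof.
move=> [v vd ->] [w wd ->]; exists (v + w); last by rewrite raddfD.
by apply: leq_trans (mmeasureD_le _ _ _) _; rewrite geq_max vd wd.
Qed.

Lemma fil_sum d (I : eqType) (r : seq I) (F : I -> U) :
  (forall i, i \in r -> fil d (F i)) -> fil d (\sum_(i <- r) F i).
Proof.
move=> rF; rewrite big_seq; elim/big_ind: _ => //; first exact: fil0.
exact: filD.
Qed.

Lemma fil_trans d y x z : fil d (x - y) -> fil d (y - z) -> fil d (x - z).
Proof. by move=> h1 h2; have := filD h1 h2; rewrite addrA subrK. Qed.

Lemma average_const (T : Type) (e : seq T) (x : U) : (size e)%:R != 0 :> C ->
  x = (size e)%:R^-1 *: \sum_(t <- e) x.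
Proof.
move=> e0; rewrite big_const_seq count_predT iter_addr_0 -(scaler_nat _ x).
by rewrite scalerA mulVf ?scale1r.
Qed.

(* Exchanging two factors costs a bracket, which lowers the degree by one, so
   the symmetrization of a monomial has the monomial as its leading term. *)
Lemma umon_perm_and_lead d :
  (forall s t, size s = d -> perm_eq s t -> fil d (umon s - umon t)) /\
  (forall s, size s = d -> fil d (umon s - q 1 (smon s))).
Proof.
elim/ltn_ind: d => d IH.
(* A shorter word is its own symmetrization plus lower terms, by the induction hypothesis, and both
   have degree below [d]. *)
have low s : (size s < d)%N -> fil d (umon s).
  move=> sd; have [_ /(_ s erefl) [v vd e]] := IH _ sd.
  exists (v + smon s); last by rewrite linearD -e subrK.
  apply: leq_trans (mmeasureD_le _ _ _) _; rewrite geq_max.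
  by rewrite (leq_trans vd (ltnW sd)) (leq_trans (msize_smon s) sd).
have swap a i l b : size (a ++ i :: l :: b) = d ->
    fil d (umon (a ++ i :: l :: b) - umon (a ++ l :: i :: b)).
  move=> sd; have [zeta hz] := bracket i l.
  have -> : umon (a ++ i :: l :: b) - umon (a ++ l :: i :: b) =
      \sum_(k < n) (zeta 0 k)%:C *: umon (a ++ k :: b).
    rewrite !umon_cat /umon !big_cons -mulrBr !mulrA -mulrBl hz.
    rewrite /lin_ext mulr_suml mulr_sumr; apply: eq_bigr => k _.
    by rewrite /umon big_cat big_cons /= -scalerAl -scalerAr mulrA.
  apply: fil_sum => k _; apply/filZ/low; rewrite -sd !size_cat /=.
  by rewrite ltn_add2l.
(* The prefix [a] collects letters already in place: the first letter of [s] joins it, and the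
   induction hypothesis rearranges the rest. *)
have perm s : forall t a, perm_eq s t -> size (a ++ s) = d ->
    fil d (umon (a ++ s) - umon (a ++ t)).
  elim: s => [t a|i s IHs t a st sd].
    by rewrite perm_sym => /perm_nilP -> _; rewrite subrr; exact: fil0.
  have it : i \in t by rewrite -(perm_mem st) mem_head.
  case/path.splitPr: t / it st => t1 t2 st.
  apply: (fil_trans (y := umon (a ++ i :: (t1 ++ t2)))).
    rewrite -!cat_rcons; apply: IHs; last by rewrite cat_rcons.
    rewrite -(perm_cons i); apply: perm_trans st _.
    by rewrite -cat_cons -cat_rcons perm_cat2r perm_rcons.
  have {}sd : size (a ++ i :: t1 ++ t2) = d.
    by rewrite -sd !size_cat (perm_size st) /= !size_cat /= !addnS.
  (* The letter [i] is moved to the right across [t1] by adjacent exchanges, the letters it passes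
     joining the prefix. *)
  elim: t1 a sd {IHs st} => [|k t1 IHt] a sd /=; first by rewrite subrr; exact: fil0.
  apply: (fil_trans (y := umon (a ++ k :: i :: (t1 ++ t2)))); first exact: swap.
  have := IHt (rcons a k); rewrite !cat_rcons; apply.
  by rewrite -sd !size_cat.
have {}perm s t : size s = d -> perm_eq s t -> fil d (umon s - umon t).
  by move=> sd /(perm s t [::]) /(_ sd).
split=> // s sd.
have [r [/allP sr r0 ->]] := q_smon 1 s.
rewrite expr1n mul1r.
have r00 : (size r)%:R != 0 :> C by rewrite pnatr_eq0 -lt0n.
have -> : umon s = (size r)%:R^-1 *: \sum_(t <- r) umon s.
  exact: average_const.
rewrite -scalerBr -sumrB; apply/filZ/fil_sum => t tr.
exact/perm/sr.
Qed.

(** The product of two averages is a double average of words, each a rearrangement of [s ++ t], and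
    rearranging costs only lower terms. *)
Lemma fil_qM s t :
  fil (size s + size t) (q 1 (smon s) * q 1 (smon t) - q 1 (smon (s ++ t))).
Proof.
have [hp hl] := umon_perm_and_lead (size s + size t).
apply: (fil_trans (y := umon (s ++ t))); last by apply: hl; rewrite size_cat.
have [r [/allP sr r0 ->]] := q_smon 1 s.
have [r' [/allP sr' r'0 ->]] := q_smon 1 t.
rewrite !expr1n !mul1r -scalerAl -scalerAr.
have r00 : (size r)%:R != 0 :> C by rewrite pnatr_eq0 -lt0n.
have r'00 : (size r')%:R != 0 :> C by rewrite pnatr_eq0 -lt0n.
rewrite (average_const (umon (s ++ t)) r00) // -scalerBr; apply: filZ.
rewrite mulr_suml scaler_sumr -sumrB; apply: fil_sum => a ar.
rewrite [X in _ - X](average_const (umon (s ++ t)) r'00) // mulr_sumr -scalerBr; apply: filZ.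
rewrite -sumrB; apply: fil_sum => b br; rewrite -umon_cat -opprB -scaleN1r.
apply/filZ/hp; first by rewrite size_cat.
by apply: perm_cat; [exact: sr | exact: sr'].
Qed.

(** On degree k the map [q z] carries the factor z^k. All homogeneity of the star products comes
    from this. *)
Lemma q_dilate z a v : q (a * z) v = q z (dilate a v).
Proof.
elim/(@smon_ind n C): v => [|b v w hv hw|s].
- by rewrite !linear0.
- by rewrite !linearP hv hw.
rewrite (dilate_homog _ (smon_homog _ s)) linearZ /=.
rewrite smon_sym_of; case: qP => _ E; rewrite !E scalerA exprMn; congr (_ *: _).
by rewrite mulrA.
Qed.

Lemma q_inj z : z != 0 -> injective (q z).
Proof. by case: qP => h _ /h/bij_inj. Qed.

(** [is_gutt] does not mention linearity: it is pulled back from the algebra by the injective [q z],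
    and at zero it is that of the ordinary product. *)
Lemma gutt_linearr z v : linear (gutt z v).
Proof.
case: guttP => h h0 a w w'; have [->|z0] := eqVneq z 0.
  by rewrite !h0 mulrDr -scalerAr.
by apply: (q_inj z0); rewrite linearP !h // linearP mulrDr -scalerAr.
Qed.

Lemma gutt_linearl z w : linear (gutt z ^~ w).
Proof.
case: guttP => h h0 a v v'; have [->|z0] := eqVneq z 0.
  by rewrite !h0 mulrDl -scalerAl.
by apply: (q_inj z0); rewrite linearP !h // linearP mulrDl -scalerAl.
Qed.

(** The product of the enveloping algebra does not depend on the parameter, so changing the
    parameter conjugates the Gutt product by a dilation; on homogeneous arguments two of the three
    dilations are scalars. *)
Lemma gutt_dilate a z k l v w : a != 0 -> z != 0 ->
  v \is ishomog1 k mdeg -> w \is ishomog1 l mdeg ->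
  gutt (a * z) v w = a ^+ (k + l) *: dilate a^-1 (gutt z v w).
Proof.
move=> a0 z0 vk wl; have az : a * z != 0 by rewrite mulf_neq0.
case: guttP => h _; apply: (q_inj az); rewrite h // linearZ /= !q_dilate.
rewrite dilateK ?divff // h // (dilate_homog _ vk) (dilate_homog _ wl) !linearZ /=.
by rewrite -scalerAl -scalerAr scalerA -exprD.
Qed.

(** The strict drop in degree of the remainder [x] is what will give it positive powers of the
    parameter. *)
Lemma gutt_smon (s t : seq 'I_n) :
  exists2 x : Sym, (mmeasure mdeg x <= size s + size t)%N &
  gutt 1 (smon s) (smon t) = smon s * smon t + x.
Proof.
have [x xd xE] := fil_qM s t; exists x => //; case: guttP => h _.
apply: (q_inj (oner_neq0 _)); rewrite h ?oner_neq0 //.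
by rewrite linearD /= -xE smon_cat addrC subrK.
Qed.

(** For monomials of degrees k and l, passing from parameter 1 to z multiplies the degree d part by
    z^(k + l - d), and no d exceeds k + l. *)
Lemma gutt_polynomial v w : polynomial_map (fun z => gutt z v w).
Proof.
elim/(@smon_ind n C): v => [|b v v' hv hv'|s].
- apply: eq_polynomial (polynomial0 _) => z.
  have := gutt_linearl z w 1 0 0; rewrite scaler0 scale1r addr0 => h.
  by apply: (@addrI _ (gutt z 0 w)); rewrite addr0 -h.
- have := polynomialD (polynomial_powZ 0 b hv) hv'.
  by apply: eq_polynomial => z; rewrite gutt_linearl expr0 mulr1.
elim/(@smon_ind n C): w => [|b v v' hv hv'|t].
- apply: eq_polynomial (polynomial0 _) => z.
  have := gutt_linearr z (smon s) 1 0 0; rewrite scaler0 scale1r addr0 => h.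
  by apply: (@addrI _ (gutt z (smon s) 0)); rewrite addr0 -h.
- have := polynomialD (polynomial_powZ 0 b hv) hv'.
  by apply: eq_polynomial => z; rewrite gutt_linearr expr0 mulr1.
have [x xd xE] := gutt_smon s t.
apply: (@eq_polynomial _ _ (fun z => z ^+ 0 *: (smon s * smon t) +
    \sum_(m <- msupp x) z ^+ (size s + size t - mdeg m) *: (mcoeff m x *: mpolyX C m))).
  move=> z; rewrite scale1r; have [->|z0] := eqVneq z 0.
    (* At zero only the ordinary product may remain: all exponents of the remainder are positive,
       since its degree is below [size s + size t]. *)
    case: guttP => _ ->; rewrite big_seq big1 ?addr0 // => m mx.
    rewrite expr0n subn_eq0 leqNgt; have := leq_trans (msize_mdeg_lt mx) xd.
    by move=> ->; rewrite scale0r.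
  rewrite -[in RHS](mulr1 z) (gutt_dilate z0 (oner_neq0 _) (smon_homog _ s) (smon_homog _ t)).
  rewrite xE linearD /= scalerDr -smon_cat (dilate_homog _ (smon_homog _ _)).
  rewrite size_cat scalerA -exprMn divff // expr1n scale1r; congr (_ + _).
  rewrite /dilate scaler_sumr; apply: eq_big_seq => m mx.
  rewrite !scalerA mulrA; congr ((_ * _) *: _).
  have /ltnW hm := leq_trans (msize_mdeg_lt mx) xd.
  by rewrite -[in RHS](subnK hm) exprD exprVn mulfK // expf_neq0.
apply: polynomialD; first exact: polynomial_monomial.
by apply: polynomial_sum => m; exact: polynomial_monomial.
Qed.

End Gutt.

(** * Seminorms of polynomials on the cotangent bundle *)

Section Infima.
Variable R : realType.
Implicit Types S T : set R.

Lemma inf_ge0 S : (forall t, S t -> 0 <= t) -> 0 <= inf S.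
Proof.
move=> S0; have [->|/set0P ne] := eqVneq S set0; first by rewrite inf0.
exact: lb_le_inf.
Qed.

(** Seminorms defined as infima over representations are compared by transforming representations.
    Nonemptiness of [S] excludes the conventional value 0 of [inf set0]. *)
Lemma inf_le_scale S T b : 0 <= b -> S !=set0 -> (forall t, T t -> 0 <= t) ->
  (forall s, S s -> exists2 t, T t & t <= b * s) -> inf T <= b * inf S.
Proof.
move=> b0 S0 T0 ST.
have Tle s : S s -> inf T <= b * s.
  move=> /ST[t Tt]; apply: le_trans; apply: ge_inf => //.
  by exists 0 => x; exact: T0.
move: b0; rewrite le_eqVlt => /predU1P[b0|b0].
  by case: S0 => s /Tle; rewrite -b0 !mul0r.
rewrite mulrC -ler_pdivrMr //; apply: lb_le_inf => // s /Tle.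
by rewrite mulrC -ler_pdivrMr.
Qed.

Lemma inf_le_add S S' T : S !=set0 -> S' !=set0 -> (forall t, T t -> 0 <= t) ->
  (forall s s', S s -> S' s' -> exists2 t, T t & t <= s + s') ->
  inf T <= inf S + inf S'.
Proof.
move=> S0 S'0 T0 ST; rewrite -lerBlDr; apply: lb_le_inf => // s Ss.
rewrite lerBlDr -lerBlDl; apply: lb_le_inf => // s' Ss'.
rewrite lerBlDl; have [t Tt] := ST _ _ Ss Ss'; apply: le_trans.
by apply: ge_inf => //; exists 0 => x; exact: T0.
Qed.

End Infima.

(** * The real-valued modulus of complex numbers *)

Section Normc.
Variable R : realType.
Implicit Types x y : R[i].

Lemma normc_ge0 x : 0 <= normc x.
Proof. by case: x => a b; exact: sqrtr_ge0. Qed.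

Lemma normcD x y : normc (x + y) <= normc x + normc y.
Proof. exact: le_normcD. Qed.

Lemma normcX x k : normc (x ^+ k) = normc x ^+ k.
Proof. by elim: k => [|k IH]; rewrite ?Normc.normc1 // !exprS Normc.normcM IH. Qed.

Lemma normc_eq0 x : (normc x == 0) = (x == 0).
Proof.
by apply/eqP/eqP => [/Normc.eq0_normc|->]; rewrite ?Normc.normc0.
Qed.

Lemma normc_gt0 x : (0 < normc x) = (x != 0).
Proof. by rewrite lt_def normc_ge0 andbT normc_eq0. Qed.

Lemma normc_norm x : `|x| = (normc x)%:C.
Proof. by rewrite normc_def; case: x. Qed.

Lemma normc_real (a : R) : normc a%:C = `|a|.
Proof. by rewrite /= expr0n addr0 sqrtr_sqr. Qed.

End Normc.

(** * Projective norms on the symmetric algebra *)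

Section SymmetricNorms.
Variables (R : realType) (n : nat).
Local Notation C := R[i].
Local Notation Sym := (symalg R n).

Lemma l1norm_ge0 (x : 'rV[C]_n) : 0 <= l1norm x.
Proof. by rewrite sumr_ge0 // => i _; exact: normc_ge0. Qed.

Lemma proj_norm_ge0 k (v : Sym) : 0 <= proj_norm k v.
Proof.
apply: inf_ge0 => _ [s [_ ->]]; rewrite sumr_ge0 // => x _.
by rewrite mulr_ge0 ?normc_ge0 // prodr_ge0 // => i _; exact: l1norm_ge0.
Qed.

Lemma pnorm_ge0 (r' c : R) (v : Sym) : 0 <= c -> 0 <= pnorm r' c v.
Proof.
move=> c0; rewrite sumr_ge0 // => k _.
by rewrite !mulr_ge0 ?powR_ge0 ?exprn_ge0 ?proj_norm_ge0.
Qed.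

(** Ensures that the infimum in [proj_norm] runs over a nonempty set. *)
Lemma tensor_expansion k (f : {ffun k.-tuple 'I_n -> C}) :
  exists s : seq (C * ('I_k -> 'rV[C]_n)),
    f = [ffun al => \sum_(x <- s) x.1 * pure_tensor x.2 al].
Proof.
exists [seq (f be, fun i => delta_mx 0 (tnth be i)) | be <- index_enum (k.-tuple 'I_n : finType)].
apply/ffunP => al; rewrite ffunE big_map (bigD1 al) //= ffunE.
rewrite big1 => [|i _]; last by rewrite mxE !eqxx.
rewrite mulr1 big1 ?addr0 // => be beal; rewrite ffunE.
have [i ni] : exists i, tnth al i != tnth be i.
  apply/existsP; apply: contraNT beal; rewrite negb_exists => /forallP h.
  by apply/eqP/esym/eq_from_tnth => i; apply/eqP; have := h i; rewrite negbK.
by rewrite (bigD1 i) //= mxE eqxx (negPf ni) mul0r mulr0.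
Qed.

(** Only the components of degree k are compared, so that [w] may be a dilation of [v], a different
    multiple in each degree. *)
Lemma proj_norm_le k (b : C) (v w : Sym) :
  (forall al, sym_tensor k w al = b * sym_tensor k v al) ->
  proj_norm k w <= normc b * proj_norm k v.
Proof.
move=> wv; apply: (inf_le_scale (normc_ge0 b)).
- by have [s e] := tensor_expansion (sym_tensor k v); eexists; exists s.
- move=> _ [s [_ ->]]; rewrite sumr_ge0 // => x _.
  by rewrite mulr_ge0 ?normc_ge0 // prodr_ge0 // => i _; exact: l1norm_ge0.
move=> _ [s [e ->]].
eexists.
  exists [seq (b * x.1, x.2) | x <- s]; split; last by [].
  apply/ffunP => al; rewrite wv e !ffunE big_map mulr_sumr.
  by apply: eq_bigr => x _; rewrite mulrA.
rewrite big_map mulr_sumr ler_sum // => x _.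
by rewrite Normc.normcM mulrA.
Qed.

Lemma mdeg_multiplicities k (al : k.-tuple 'I_n) : mdeg (multiplicities al) = k.
Proof.
rewrite mdegE -[RHS](size_tuple al).
under eq_bigr do rewrite mnmE.
elim: (val al) => [|i s IH] /=; first by rewrite big1.
rewrite big_split /= IH (bigD1 i) //= eqxx big1 // => l /negPf il.
by rewrite eq_sym il.
Qed.

(** In degree i the factor b^i is absorbed by the weight c^i. *)
Lemma pnorm_dilate_le (r' c : R) (a b : C) (v : Sym) : 0 <= c ->
  pnorm r' c (a *: dilate b v) <= normc a * pnorm r' (normc b * c) v.
Proof.
move=> c0; rewrite /pnorm mulr_sumr.
set N := mmeasure mdeg v; set M := mmeasure mdeg _.
(* A dilation by zero loses degrees, so the left sum may be shorter; it is padded with nonnegative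
   terms. *)
have MN : (M <= N)%N.
  exact: leq_trans (mmeasureZ_le _ _ _) (msize_dilate _ _).
pose F (i : nat) := i`!%:R `^ r' * c ^+ i * proj_norm i (a *: dilate b v).
rewrite -[leLHS]/(\sum_(i < M) F i) (big_ord_widen _ F MN) big_mkcond /=.
apply: ler_sum => i _; have FE : F i <= normc a * (i`!%:R `^ r' * (normc b * c) ^+ i * proj_norm i v).
  rewrite /F exprMn [X in _ <= X](_ : _ = i`!%:R `^ r' * c ^+ i * (normc (a * b ^+ i) * proj_norm i v)).
    rewrite ler_wpM2l ?mulr_ge0 ?powR_ge0 ?exprn_ge0 // proj_norm_le // => al.
    rewrite !ffunE mcoeffZ mcoeff_dilate mdeg_multiplicities !mulrA; ring.
  rewrite Normc.normcM normcX; ring.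
case: ifP => // _; rewrite mulr_ge0 ?normc_ge0 // !mulr_ge0 ?powR_ge0 ?exprn_ge0 ?proj_norm_ge0 //.
by rewrite mulr_ge0 ?normc_ge0.
Qed.

End SymmetricNorms.

(** * Projective tensor seminorms on polynomials *)

Section PolSeminorms.
Variables (R : realType) (n : nat) (G : topGroupType) (A : set (chart R n G)).
Variables (X : 'I_n -> (G -> R) -> (G -> R)) (r r' : R).
Local Notation C := R[i].
Local Notation Sym := (symalg R n).
Implicit Types (P Q : G -> Sym) (s : seq ((G -> C) * Sym)).

Lemma qnorm_ge0 c phi : 0 <= c -> (0 <= qnorm X r c phi)%E.
Proof.
move=> c0; apply: nneseries_ge0 => k _ _; rewrite lee_fin.
rewrite !mulr_ge0 ?powR_ge0 ?exprn_ge0 // sumr_ge0 // => al _.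
exact: normc_ge0.
Qed.

Lemma repr_ge0 c c' s : 0 <= c -> 0 <= c' ->
  0 <= \sum_(x <- s) fine (qnorm X r c x.1) * pnorm r' c' x.2.
Proof.
move=> c0 c'0; rewrite sumr_ge0 // => x _.
by rewrite mulr_ge0 ?pnorm_ge0 // fine_ge0 // qnorm_ge0.
Qed.

Lemma pol_norm_ge0 c c' P : 0 <= c -> 0 <= c' -> 0 <= pol_norm A X r r' c c' P.
Proof. by move=> c0 c'0; apply: inf_ge0 => _ [s [_ ->]]; exact: repr_ge0. Qed.

(** Scalar multiples ([b = 1]) and dilations ([a = 1]) are handled at once. *)
Lemma represents_dilate a b s P : represents A X r s P ->
  represents A X r [seq (x.1, a *: dilate b x.2) | x <- s]
    (fun g => a *: dilate b (P g)).
Proof.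
move=> [se ->]; split=> [_ /mapP[x /se xe ->] //|].
apply/funext => g; rewrite big_map (linear_sum (dilate b)) scaler_sumr; apply: eq_bigr => x _.
by rewrite /tens /= linearZ /= !scalerA mulrC.
Qed.

Lemma represents_cat s t P Q : represents A X r s P -> represents A X r t Q ->
  represents A X r (s ++ t) (P + Q).
Proof.
move=> [se ->] [te ->]; split=> [x|]; first by rewrite mem_cat => /orP[/se|/te].
by apply/funext => g; rewrite big_cat.
Qed.

Lemma Pol_dilate a b P : Pol A X r P -> Pol A X r (fun g => a *: dilate b (P g)).
Proof. by move=> [s /(represents_dilate a b) sP]; eexists; exact: sP. Qed.

Lemma dilate1 (v : Sym) : dilate 1 v = v.
Proof. by apply/mpolyP => m; rewrite mcoeff_dilate expr1n mul1r. Qed.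

Lemma PolZ a P : Pol A X r P -> Pol A X r (a *: P).
Proof.
move=> /(Pol_dilate a 1); congr (Pol _ _ _ _).
by apply/funext => g; rewrite dilate1.
Qed.

Lemma PolD P Q : Pol A X r P -> Pol A X r Q -> Pol A X r (P + Q).
Proof. by move=> [s sP] [t tQ]; exists (s ++ t); exact: represents_cat. Qed.

Lemma Pol0 : Pol A X r 0.
Proof. by exists [::]; split=> //; apply/funext => g; rewrite big_nil. Qed.

Lemma Pol_sum (I : Type) (e : seq I) (F : I -> G -> Sym) :
  (forall i, Pol A X r (F i)) -> Pol A X r (\sum_(i <- e) F i).
Proof. by move=> FP; elim/big_ind: _ => //; [exact: Pol0|exact: PolD]. Qed.

Lemma Pol_tens phi v : entire_functions A X r phi -> Pol A X r (tens phi v).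
Proof.
move=> phie; exists [:: (phi, v)]; split=> [x|]; first by rewrite inE => /eqP ->.
by apply/funext => g; rewrite big_seq1.
Qed.

(** The star product is prescribed on factorizing tensors only; bilinearity reduces statements about
    it to tensors with monomials. *)
Lemma Pol_ind (Z : (G -> Sym) -> Prop) : Z 0 ->
  (forall a P Q, Pol A X r P -> Pol A X r Q -> Z P -> Z Q -> Z (a *: P + Q)) ->
  (forall phi (e : seq 'I_n), entire_functions A X r phi -> Z (tens phi (smon e))) ->
  forall P, Pol A X r P -> Z P.
Proof.
move=> Z0 ZD Zt P [s [se ->]].
have Ztens phi v : entire_functions A X r phi -> Z (tens phi v).
  move=> phie; elim/(@smon_ind n C): v => [|a v w Zv Zw|e]; last exact: Zt.
    by rewrite (_ : tens phi 0 = 0) //; apply/funext => g; exact: scaler0.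
  rewrite (_ : tens phi _ = a *: tens phi v + tens phi w).
    by apply: ZD => //; exact: Pol_tens.
  by apply/funext => g; rewrite /tens scalerDr scalerA mulrC -scalerA.
elim: s se => [|x s IH] se.
  by rewrite (_ : (fun g => _) = 0) //; apply/funext => g; rewrite big_nil.
rewrite (_ : (fun g => _) = 1 *: tens x.1 x.2 + (fun g => \sum_(y <- s) tens y.1 y.2 g)).
  have xe := se x (mem_head _ _).
  have {}se y : y \in s -> entire_functions A X r y.1.
    by move=> ys; apply: se; rewrite in_cons ys orbT.
  apply: ZD; [exact: Pol_tens| |exact: Ztens|exact: IH].
  by exists s.
by apply/funext => g; rewrite scale1r big_cons.
Qed.

Lemma pol_norm_dilate_le c c' a b P : 0 <= c -> 0 <= c' -> Pol A X r P ->
  pol_norm A X r r' c c' (fun g => a *: dilate b (P g)) <=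
  normc a * pol_norm A X r r' c (normc b * c') P.
Proof.
move=> c0 c'0 [s0 s0P]; apply: (inf_le_scale (normc_ge0 a)).
- by eexists; exists s0.
- by move=> _ [s [_ ->]]; exact: repr_ge0.
move=> _ [s [sP ->]]; eexists.
  by eexists; split; [exact: represents_dilate sP|].
rewrite big_map mulr_sumr ler_sum // => x _; rewrite mulrCA.
by rewrite ler_wpM2l ?pnorm_dilate_le // fine_ge0 // qnorm_ge0.
Qed.

Lemma pol_normZ_le c c' a P : 0 <= c -> 0 <= c' -> Pol A X r P ->
  pol_norm A X r r' c c' (a *: P) <= normc a * pol_norm A X r r' c c' P.
Proof.
move=> c0 c'0 PP; have := pol_norm_dilate_le a 1 c0 c'0 PP.
rewrite Normc.normc1 mul1r; congr (pol_norm _ _ _ _ _ _ _ <= _).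
by apply/funext => g; rewrite dilate1.
Qed.

Lemma pol_normD_le c c' P Q : 0 <= c -> 0 <= c' -> Pol A X r P -> Pol A X r Q ->
  pol_norm A X r r' c c' (P + Q) <=
  pol_norm A X r r' c c' P + pol_norm A X r r' c c' Q.
Proof.
move=> c0 c'0 [s0 s0P] [t0 t0Q]; apply: inf_le_add.
- by eexists; exists s0.
- by eexists; exists t0.
- by move=> _ [s [_ ->]]; exact: repr_ge0.
move=> _ _ [s [sP ->]] [t [tQ ->]]; eexists.
  by eexists; split; [exact: represents_cat sP tQ|].
by rewrite big_cat.
Qed.

End PolSeminorms.

(** * Seminormed spaces and bilinear maps *)

Section Seminorms.
Variables (R : realType) (H : tvsType R[i]) (I : Type) (N : I -> H -> R).

(** [nbhs_semi] asks for a single seminorm, not for finitely many: the family is directed, like the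
    one indexed by pairs of weights. *)
Record generating_seminorms : Prop := GeneratingSeminorms {
  semi_ge0 : forall i x, 0 <= N i x;
  semiD : forall i x y, N i (x + y) <= N i x + N i y;
  semiZ : forall i a x, N i (a *: x) <= normc a * N i x;
  semi_nbhs : forall i e, 0 < e -> nbhs 0 [set x | N i x < e];
  nbhs_semi : forall V : set H, nbhs 0 V ->
    exists i e, 0 < e /\ forall x, N i x < e -> V x }.

Hypothesis NP : generating_seminorms.
Hypothesis Hhaus : hausdorff_space H.

Lemma semi0 i : N i 0 = 0.
Proof.
apply/eqP; rewrite eq_le (semi_ge0 NP) andbT.
by have := semiZ NP i 0 0; rewrite scale0r Normc.normc0 mul0r.
Qed.

Lemma semiN i x : N i (- x) = N i x.
Proof.
have h y : N i (- y) <= N i y.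
  have := semiZ NP i (-1) y.
  by rewrite scaleN1r /= oppr0 expr0n addr0 sqrtr_sqr normrN normr1 mul1r.
by apply/eqP; rewrite eq_le h -{1}(opprK x) h.
Qed.

Lemma semiB i x y : N i (x - y) <= N i x + N i y.
Proof. by rewrite -(semiN i y); exact: semiD. Qed.

Lemma semi_distC i x y : N i (x - y) = N i (y - x).
Proof. by rewrite -opprB semiN. Qed.

Lemma semi_sum i (T : Type) (s : seq T) (F : T -> H) :
  N i (\sum_(t <- s) F t) <= \sum_(t <- s) N i (F t).
Proof.
elim: s => [|t s IH]; first by rewrite !big_nil semi0.
by rewrite !big_cons (le_trans (semiD NP _ _ _)) // lerD2l.
Qed.

(** The seminorms describe neighborhoods of 0; continuity of translations carries this to [x],
    without reference to the uniform structure. *)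
Lemma nbhs_semiP x (V : set H) : nbhs x V <->
  exists i e, 0 < e /\ forall y, N i (y - x) < e -> V y.
Proof.
split=> [Vx|[i [e [e0 eV]]]].
  have : nbhs 0 [set h | V (h + x)].
    have h : continuous (fun h : H => h + x).
      move=> z; apply: (@continuous_comp _ _ _ (fun h => (h, x)) (fun p : H * H => p.1 + p.2)).
        by apply: cvg_pair; [exact: cvg_id|exact: cvg_cst].
      exact: add_continuous.
    by have := h 0 V; rewrite /= add0r; exact.
  move=> /(nbhs_semi NP)[i [e [e0 h]]]; exists i, e; split=> // y /h /=.
  by rewrite subrK.
have h : continuous (fun h : H => h - x).
  move=> z; apply: (@continuous_comp _ _ _ (fun h => (h, - x)) (fun p : H * H => p.1 + p.2)).
    by apply: cvg_pair; [exact: cvg_id|exact: cvg_cst].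
  exact: add_continuous.
have : nbhs x [set y | N i (y - x) < e].
  by have := h x [set y | N i y < e]; rewrite /= subrr; apply; exact: semi_nbhs.
exact: filterS eV.
Qed.

Lemma cvg_semiP (T : Type) (F : set_system T) {FF : Filter F} (f : T -> H) x :
  (f @ F --> x) <-> forall i e, 0 < e -> \forall t \near F, N i (f t - x) < e.
Proof.
split=> [fx i e e0|h V /nbhs_semiP[i [e [e0 eV]]]].
  have /fx// : nbhs x [set y | N i (y - x) < e].
  by apply/nbhs_semiP; exists i, e.
by apply: filterS (h i e e0) => t; exact: eV.
Qed.

Lemma semi_continuous i : continuous (N i : H -> R).
Proof.
move=> x; apply/cvgrPdist_lt => e e0.
apply: filterS (_ : nbhs x [set y | N i (y - x) < e]) => [y /= h|]; last first.
  by apply/nbhs_semiP; exists i, e.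
apply: le_lt_trans h; rewrite ler_norml lerBlDr lerBrDl.
have := semiD NP i (y - x) x; have := semiD NP i (x - y) y.
rewrite !subrK (semi_distC i x y) => h1 h2; apply/andP; split; lra.
Qed.

Lemma cvg_semi_unique (f : nat -> H) (x y : H) : (f @ \oo --> x) -> (f @ \oo --> y) -> x = y.
Proof. by move=> fx fy; apply: (@cvg_unique H Hhaus (f @ \oo)). Qed.

Lemma cvg_semi_le i (f : nat -> H) (x : H) M : (f @ \oo --> x) ->
  (\forall k \near \oo, N i (f k) <= M) -> N i x <= M.
Proof.
move=> /cvg_semiP fx fM; rewrite leNgt; apply/negP => Mx.
have e0 : 0 < N i x - M by rewrite subr_gt0.
have [k [/= h1 h2]] := filter_ex (filterI fM (fx i _ e0)).
have := semiD NP i (f k) (x - f k); rewrite addrC subrK (semi_distC i x) => h3.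
suff : N i x < N i x by rewrite ltxx.
lra.
Qed.

Definition bounded_bilinear (S : H -> H -> H) : Prop :=
  [/\ forall P, linear (S P), forall Q, linear (S^~ Q) &
    forall i, exists i1 i2 K, 0 <= K /\
      forall P Q, N i (S P Q) <= K * N i1 P * N i2 Q].

(** Continuity at the origin bounds [S] by 1 on a product of two balls, and rescaling the arguments
    into these balls gives the estimate. *)
Lemma continuous_bilinear_bounded (S : H -> H -> H) :
  continuous_bilinear S -> bounded_bilinear S.
Proof.
move=> [Sr Sl Sc]; split=> // i.
have S00 : S 0 0 = 0.
  have := Sr 0 1 0 0; rewrite !scale1r !addr0 => h.
  by apply: (@addrI _ (S 0 0)); rewrite addr0 -h.
have SZ a b P Q : S (a *: P) (b *: Q) = (a * b) *: S P Q.
  have Sr0 x : S x 0 = 0.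
    have := Sr x 1 0 0; rewrite !scale1r !addr0 => h.
    by apply: (@addrI _ (S x 0)); rewrite addr0 -h.
  have Sl0 y : S 0 y = 0.
    have := Sl y 1 0 0; rewrite !scale1r !addr0 => h.
    by apply: (@addrI _ (S 0 y)); rewrite addr0 -h.
  have := Sr (a *: P) b Q 0; rewrite !addr0 Sr0 addr0 => ->.
  have := Sl Q a P 0; rewrite !addr0 Sl0 addr0 => ->.
  by rewrite scalerA mulrC.
have : nbhs (0, 0) [set PQ : H * H | N i (S PQ.1 PQ.2) < 1].
  have := Sc (0, 0) [set x | N i x < 1]; rewrite /= S00; apply.
  exact: semi_nbhs.
move=> [[V1 V2] [/= V1n V2n] h].
have [i1 [e1 [e10 h1]]] := nbhs_semi NP V1n.
have [i2 [e2 [e20 h2]]] := nbhs_semi NP V2n.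
exists i1, i2, (e1^-1 * e2^-1); split; first by rewrite mulr_ge0 ?invr_ge0 ?ltW.
move=> P Q.
(* The seminorms of [P] and [Q] may vanish, so the rescaling uses strict upper bounds [s] and [t],
   which afterwards tend to them. *)
have main s t : N i1 P < s -> N i2 Q < t -> N i (S P Q) <= (s / e1) * (t / e2).
  move=> Ps Qt.
  have s0 : 0 < s := le_lt_trans (semi_ge0 NP _ _) Ps.
  have t0 : 0 < t := le_lt_trans (semi_ge0 NP _ _) Qt.
  have sc (x : R) : 0 < x -> normc (x%:C) = x by move=> x0; rewrite normc_real gtr0_norm.
  have := h ((e1 / s)%:C *: P, (e2 / t)%:C *: Q); rewrite /= SZ.
  have hV : V1 ((e1 / s)%:C *: P) /\ V2 ((e2 / t)%:C *: Q).
    split; [apply: h1|apply: h2]; apply: le_lt_trans (semiZ NP _ _ _) _.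
      by rewrite sc ?divr_gt0 // mulrAC ltr_pdivrMr // ltr_pM2l.
    by rewrite sc ?divr_gt0 // mulrAC ltr_pdivrMr // ltr_pM2l.
  move=> /(_ hV) /ltW h3.
  have sK : (s / e1 * (t / e2))%:C *: ((e1 / s)%:C * (e2 / t)%:C *: S P Q) = S P Q.
    rewrite scalerA -!rmorphM /= [X in X%:C](_ : _ = 1) ?rmorph1 ?scale1r //.
    by field; rewrite !gt_eqF.
  rewrite -[X in N i X]sK; apply: le_trans (semiZ NP _ _ _) _.
  rewrite sc; last by rewrite mulr_gt0 // divr_gt0.
  by rewrite ler_piMr // mulr_ge0 // divr_ge0 // ltW.
have {}main d : 0 < d -> N i (S P Q) <= ((N i1 P + d) / e1) * ((N i2 Q + d) / e2).
  by move=> d0; apply: main; rewrite ltrDl.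
apply/ler_addgt0Pl => e e0.
set p := N i1 P; set w := N i2 Q.
have p0 : 0 <= p by exact: semi_ge0.
have w0 : 0 <= w by exact: semi_ge0.
(* As d <= 1, the excess (p + d)(w + d) - p w is at most d (p + w + 1). *)
pose d := Num.min 1 (e * (e1 * e2) / (p + w + 1)).
have pw : 0 < p + w + 1 by rewrite ltr_wpDl // addr_ge0.
have d0 : 0 < d by rewrite lt_min ltr01 divr_gt0 // mulr_gt0 // mulr_gt0.
apply: le_trans (main d d0) _.
have d1 : d <= 1 by rewrite ge_min lexx.
have dpw : d * (p + w + 1) <= e * (e1 * e2).
  by rewrite -ler_pdivlMr // ge_min lexx orbT.
rewrite -/p -/w [leLHS](_ : _ = (p + d) * (w + d) / (e1 * e2)); last first.
  by field; rewrite !gt_eqF.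
rewrite ler_pdivrMr ?mulr_gt0 //.
rewrite [leRHS](_ : _ = e * (e1 * e2) + p * w); last by field; rewrite !gt_eqF.
nra.
Qed.

Lemma bounded_bilinear_continuous (S : H -> H -> H) :
  bounded_bilinear S -> continuous_bilinear S.
Proof.
move=> [Sr Sl Sb]; split=> // -[P0 Q0]; apply/cvg_semiP => i e e0.
have [i1 [i2 [K [K0 SK]]]] := Sb i.
(* The three error terms below sum to at most d (M - 1); the extra 1 keeps [M] positive and the
   final inequality strict. *)
pose M := K * (N i1 P0 + N i2 Q0 + 1) + 1.
have M0 : 0 < M.
  by rewrite ltr_wpDl // mulr_ge0 // !addr_ge0 // semi_ge0.
pose d := Num.min 1 (e / M).
have d0 : 0 < d by rewrite lt_min ltr01 divr_gt0.
exists ([set P | N i1 (P - P0) < d], [set Q | N i2 (Q - Q0) < d]).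
  by split; apply/nbhs_semiP; [exists i1, d|exists i2, d].
move=> [P Q] [/= hP hQ].
have SBr x y y' : S x (y - y') = S x y - S x y'.
  by rewrite addrC -scaleN1r Sr scaleN1r addrC.
have SBl x x' y : S (x - x') y = S x y - S x' y.
  by rewrite addrC -scaleN1r Sl scaleN1r addrC.
have -> : S P Q - S P0 Q0 = S (P - P0) (Q - Q0) + S (P - P0) Q0 + S P0 (Q - Q0).
  by rewrite (SBl P P0 (Q - Q0)) (SBl P P0 Q0) addrAC subrK SBr addrA subrK.
apply: le_lt_trans (semiD NP _ _ _) _.
have h1 := semiD NP i (S (P - P0) (Q - Q0)) (S (P - P0) Q0).
have h2 := SK (P - P0) (Q - Q0).
have h3 := SK (P - P0) Q0.
have h4 := SK P0 (Q - Q0).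
move: (semi_ge0 NP i1 P0) (semi_ge0 NP i2 Q0) (semi_ge0 NP i1 (P - P0)) (semi_ge0 NP i2 (Q - Q0)).
move: hP hQ h1 h2 h3 h4 => /ltW hP /ltW hQ h1 h2 h3 h4 a0 b0 x0 y0.
have dle : d <= 1 by rewrite ge_min lexx.
have dM : d * M <= e by rewrite -ler_pdivlMr // ge_min lexx orbT.
rewrite /M in dM.
have k2 : K * N i1 (P - P0) * N i2 (Q - Q0) <= K * d.
  by rewrite -mulrA ler_wpM2l // (le_trans (ler_pM x0 y0 hP hQ)) // ler_piMr // ltW.
have k3 : K * N i1 (P - P0) * N i2 Q0 <= K * d * N i2 Q0.
  by rewrite ler_wpM2r // ler_wpM2l.
have k4 : K * N i1 P0 * N i2 (Q - Q0) <= K * N i1 P0 * d.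
  by rewrite ler_wpM2l // mulr_ge0.
lra.
Qed.

End Seminorms.

(** * Coefficient extraction at roots of unity *)

Section RootsOfUnity.
Variable R : realType.
Local Notation C := R[i].

(** In characteristic zero X^N - 1 is separable, so over an algebraically closed field it has N
    distinct roots, and N roots of unity must include a primitive one. *)
Lemma primitive_root_exists N : (0 < N)%N -> exists w : C, N.-primitive_root w.
Proof.
move=> N0; have [rs rsE] := closed_field_poly_normal ('X^N - 1 : {poly C}).
rewrite (monicP (monic_Xn_sub_1 _ N0)) scale1r in rsE.
have rsN : size rs = N.
  by apply/succn_inj; rewrite -(size_prod_XsubC rs id) -rsE size_XnsubC.
have us : uniq rs.
  by rewrite -separable_prod_XsubC -rsE separable_Xn_sub_1 // pnatr_eq0 -lt0n.
have ur : all N.-unity_root rs.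
  by apply/allP => z; rewrite -root_prod_XsubC -rsE.
have := has_prim_root N0 ur us; rewrite rsN => /(_ (leqnn N))/hasP[w _ wP].
by exists w.
Qed.

Lemma normc_root N (w : C) : N.-primitive_root w -> normc w = 1.
Proof.
move=> wP; have N0 := prim_order_gt0 wP; apply/eqP.
by rewrite -(pexpr_eq1 N0 (normc_ge0 w)) -normcX (prim_expr_order wP) Normc.normc1.
Qed.

(** The Cauchy integral for the m-th Taylor coefficient over the unit circle, discretized at the
    N-th roots of unity. *)
Definition dft (V : lmodType C) (N : nat) (w : C) (F : C -> V) (m : nat) : V :=
  N%:R^-1 *: \sum_(i < N) ((w ^+ i) ^- m) *: F (w ^+ i).

Lemma dft_polynomial (V : lmodType C) N w (F : C -> V) a M m :
  N.-primitive_root w -> polynomial_with F a M -> (M <= N)%N -> (m < N)%N ->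
  dft N w F m = a m.
Proof.
move=> wP aP MN mN; have [_ FE] := polynomial_with_widen MN aP.
have N0 : N%:R != 0 :> C by rewrite pnatr_eq0 -lt0n (prim_order_gt0 wP).
have w0 : w != 0.
  by rewrite -normc_eq0 (normc_root wP) oner_eq0.
rewrite /dft; under eq_bigr => i _.
  rewrite FE scaler_sumr; under eq_bigr do rewrite scalerA.
  over.
rewrite exchange_big /= (bigD1 (Ordinal mN)) //= [X in _ + X]big1 ?addr0 => [|l lm]; last first.
  rewrite -scaler_suml.
  (* For l different from m the inner sum is geometric, with a ratio that is an N-th root of unity
     other than 1, so it vanishes. *)
  have : w ^+ l / w ^+ m != 1.
    rewrite -(divff (expf_neq0 m w0)) (inj_eq (mulIf _)) ?invr_eq0 ?expf_neq0 //.
    by rewrite (eq_prim_root_expr wP) !modn_small.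
  rewrite -subr_eq0 => x1.
  rewrite (eq_bigr (fun i : 'I_N => (w ^+ l / w ^+ m) ^+ i)); last first.
    by move=> i _; rewrite expr_div_n -!exprM mulrC ![(i * _)%N]mulnC.
  have -> : \sum_(i < N) (w ^+ l / w ^+ m) ^+ i = 0.
    apply: (mulfI x1); rewrite -subrX1 mulr0 expr_div_n -!exprM.
    by rewrite ![(_ * N)%N]mulnC !exprM (prim_expr_order wP) !expr1n divr1 subrr.
  by rewrite scale0r.
rewrite (eq_bigr (fun=> a m)) => [|i _]; last by rewrite mulVf ?scale1r ?expf_neq0.
by rewrite sumr_const card_ord -(scaler_nat _ (a m)) scalerA mulVf ?scale1r.
Qed.

End RootsOfUnity.

(** * Power series in a complete locally convex space *)

Section Analytic.
Variables (R : realType) (H : tvsType R[i]) (I : Type) (N : I -> H -> R).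
Local Notation C := R[i].
Hypothesis NP : generating_seminorms N.
Hypothesis Hhaus : hausdorff_space H.
Hypothesis Hcomp : forall F : set_system H, ProperFilter F -> tvs_cauchy F ->
  exists l : H, F --> l.

Lemma semi_complete (f : nat -> H) :
  (forall i e, 0 < e -> exists M, forall m k, (M <= m)%N -> (M <= k)%N ->
     N i (f m - f k) < e) ->
  exists l : H, f @ \oo --> l.
Proof.
move=> fC; apply: Hcomp => U /(nbhs_semi NP)[i [e [e0 eU]]].
have [M MP] := fC i e e0.
exists [set x | exists2 m, (M <= m)%N & x = f m].
  by exists M => // m /= Mm; exists m.
by move=> _ _ [m Mm ->] [k Mk ->]; apply/eU/MP.
Qed.

Lemma dense_nbhs (D V : set H) (x : H) : dense D -> nbhs x V -> exists2 d, D d & V d.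
Proof.
move=> Dd; rewrite nbhsE => -[W [oW Wx] WV].
by have [d [Wd Dd']] := Dd W (ex_intro _ x Wx) oW; exists d => //; exact: WV.
Qed.

(** The pairs violating the bound form an open set, which would meet the dense set of pairs from
    [D]. *)
Lemma bilinear_bound_dense (D : set H) (S : H -> H -> H) i i1 i2 K :
  dense D -> continuous_bilinear S ->
  (forall P Q, D P -> D Q -> N i (S P Q) <= K * N i1 P * N i2 Q) ->
  forall P Q, N i (S P Q) <= K * N i1 P * N i2 Q.
Proof.
move=> Dd [_ _ Sc] SD P Q; rewrite -subr_ge0 leNgt; apply/negP => h.
pose f (pq : H * H) := K * N i1 pq.1 * N i2 pq.2 - N i (S pq.1 pq.2).
have fc : f pq @[pq --> (P, Q)] --> f (P, Q).
  apply: cvgB; [apply: cvgM; [apply: cvgM; first exact: cvg_cst|]|].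
  - apply: (@cvg_comp _ _ _ fst (N i1) _ (nbhs P)); first exact: cvg_fst.
    exact: semi_continuous.
  - apply: (@cvg_comp _ _ _ snd (N i2) _ (nbhs Q)); first exact: cvg_snd.
    exact: semi_continuous.
  - apply: (@cvg_comp _ _ _ (fun pq => S pq.1 pq.2) (N i) _ (nbhs (S P Q))).
      exact: (Sc (P, Q)).
    exact: semi_continuous.
have : nbhs (P, Q) [set pq | f pq < 0] by exact: (cvgr_lt _ fc).
move=> [[V1 V2] [/= V1n V2n] VV].
have [d1 D1 W1] := dense_nbhs Dd V1n; have [d2 D2 W2] := dense_nbhs Dd V2n.
have := VV (d1, d2) (conj W1 W2); rewrite /f /= ltNge subr_ge0.
by rewrite SD.
Qed.

(** Infinite radius of convergence in every seminorm. Quantifying over all radii lets a larger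
    radius pay for polynomial or geometric factors. *)
Definition rapidly_decreasing (b : nat -> H) : Prop :=
  forall i rho, 0 < rho -> exists K, forall m, rho ^+ m * N i (b m) <= K.

(** A bound at radius 2s leaves a factor 2^-l at radius s. The scalars [c] are arbitrary in order to
    cover both powers and Taylor remainders. *)
Lemma semi_sum_geometric i (c : nat -> C) (b : nat -> H) (s K : R) m k :
  0 <= K -> 0 < s ->
  (forall l, normc (c l) <= s ^+ l) ->
  (forall l, (2 * s) ^+ l * N i (b l) <= K) ->
  N i (\sum_(m <= l < k) c l *: b l) <= 2 * K * 2^-1 ^+ m.
Proof.
move=> K0 s0 cs bK.
apply: (@le_trans _ _ (\sum_(m <= l < k) K * 2^-1 ^+ l)).
  apply: le_trans (semi_sum NP _ _ _) _; apply: ler_sum => l _.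
  apply: le_trans (semiZ NP _ _ _) _.
  apply: (@le_trans _ _ (s ^+ l * N i (b l))).
    by rewrite ler_wpM2r // semi_ge0.
  have := bK l; rewrite exprMn exprVn => h.
  by rewrite ler_pdivlMr ?exprn_gt0 // mulrC mulrA.
rewrite -mulr_sumr [2 * K]mulrC -mulrA ler_wpM2l //.
have [mk|km] := leqP m k; last by rewrite big_geq ?mulr_ge0 ?exprn_ge0 // ltnW.
have -> : \sum_(m <= l < k) 2^-1 ^+ l = 2 * (2^-1 ^+ m - 2^-1 ^+ k) :> R.
  rewrite -(subnK mk) addnC; elim: (k - m)%N => [|d IH].
    by rewrite addn0 big_geq // subrr mulr0.
  by rewrite addnS big_nat_recr ?leq_addr //= IH exprS; field.
by rewrite ler_wpM2l // gerBl exprn_ge0.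
Qed.

Lemma half_pow_small (K e : R) : 0 <= K -> 0 < e ->
  exists M, forall m, (M <= m)%N -> K * 2^-1 ^+ m < e.
Proof.
move=> K0 e0.
have h : K * 2^-1 ^+ m @[m --> \oo] --> (0 : R).
  rewrite -(mulr0 K); apply: cvgM; first exact: cvg_cst.
  by apply: cvg_expr; rewrite ger0_norm // invf_lt1 // ltr1n.
have [M _ MP] := cvgr_lt _ h _ e0.
by exists M => m Mm; exact: MP.
Qed.

Lemma power_series_cvg b z : rapidly_decreasing b ->
  exists l : H, series (fun m => z ^+ m *: b m) @ \oo --> l.
Proof.
move=> bR; apply: semi_complete => i e e0.
have s0 : 0 < normc z + 1 by rewrite ltr_wpDl // normc_ge0.
have [K bK] := bR i (2 * (normc z + 1)) (mulr_gt0 (ltr0n _ 2) s0).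
have K0 : 0 <= K.
  by apply: le_trans (bK 0%N); rewrite expr0 mul1r semi_ge0.
have [M MP] := half_pow_small (mulr_ge0 (ler0n _ 2) K0) e0.
exists M => m k.
have main m' k' : (M <= m')%N -> (m' <= k')%N ->
    N i (series (fun m => z ^+ m *: b m) k' - series (fun m => z ^+ m *: b m) m') < e.
  move=> Mm mk; rewrite sub_series_geq //.
  apply: le_lt_trans (MP m' Mm); apply: (semi_sum_geometric _ _ K0 s0) => // l.
  by rewrite normcX lerXn2r ?nnegrE ?normc_ge0 ?lerDl // addr_ge0 ?normc_ge0.
have [mk Mm _|/ltnW km _ Mk] := leqP m k; last exact: main.
by rewrite (semi_distC NP); exact: main.
Qed.

Lemma cvg_semi_linear (f g : nat -> H) (x y : H) (a : C) :
  (f @ \oo --> x) -> (g @ \oo --> y) ->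
  (fun k => a *: f k + g k) @ \oo --> a *: x + y.
Proof.
move=> /(cvg_semiP NP) fx /(cvg_semiP NP) gy; apply/(cvg_semiP NP) => i e e0.
have a0 : 0 < normc a + 1 by rewrite ltr_wpDl // normc_ge0.
have d0 : 0 < e / 2 / (normc a + 1) by rewrite !divr_gt0.
apply: filterS (filterI (fx i _ d0) (gy i _ (divr_gt0 e0 (ltr0n _ 2)))) => k [h1 h2].
rewrite opprD addrACA -scalerBr.
apply: le_lt_trans (semiD NP _ _ _) _; rewrite [ltRHS](splitr e) ltr_leD //.
  apply: le_lt_trans (semiZ NP _ _ _) _; rewrite ltr_pdivlMr // in h1.
  apply: le_lt_trans h1; rewrite mulrC ler_wpM2l ?(semi_ge0 NP) //.
  by rewrite lerDl.
exact: ltW.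
Qed.

(** With E_m the remainder, E_(m+1) = (h + z) E_m + m h^2 z^(m-1), and m^2 + m <= (m + 1)^2. At m =
    0 the truncated [m.-1] is multiplied by zero. *)
Lemma taylor_remainder_le (z h : C) (s : R) m :
  1 <= s -> normc z <= s -> normc (h + z) <= s ->
  normc ((h + z) ^+ m - z ^+ m - m%:R * h * z ^+ m.-1) <=
  normc h ^+ 2 * (m%:R ^+ 2 * s ^+ m).
Proof.
move=> s1 zs hs; have s0 : 0 <= s by lra.
elim: m => [|m IH].
  by rewrite !expr0 subrr !mul0r subr0 Normc.normc0 expr0n !mul0r mulr0.
set E := _ - _ - _ in IH.
have -> : (h + z) ^+ m.+1 - z ^+ m.+1 - m.+1%:R * h * z ^+ m =
    (h + z) * E + m%:R * h ^+ 2 * z ^+ m.-1.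
  rewrite /E; case: m {IH E} => [|m] /=; first by rewrite !expr0; ring.
  rewrite !exprS -natr1 -natr1; ring.
apply: le_trans (normcD _ _) _.
rewrite (Normc.normcM (h + z)) (Normc.normcM (m%:R * h ^+ 2)) (Normc.normcM m%:R) !normcX.
have nm : normc (m%:R : C) = m%:R.
  by rewrite -(rmorph_nat (real_complex R)) normc_real normr_nat.
rewrite nm.
have h1 : normc (h + z) * normc E <= s * (normc h ^+ 2 * (m%:R ^+ 2 * s ^+ m)).
  by rewrite ler_pM // normc_ge0.
have h2 : normc z ^+ m.-1 <= s ^+ m.+1.
  apply: (@le_trans _ _ (s ^+ m.-1)); first by rewrite lerXn2r // nnegrE normc_ge0.
  by rewrite ler_weXn2l //; lia.
have h3 : m%:R * normc h ^+ 2 * normc z ^+ m.-1 <= m%:R * normc h ^+ 2 * s ^+ m.+1.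
  by rewrite ler_wpM2l // mulr_ge0 // exprn_ge0 // normc_ge0.
apply: le_trans (lerD h1 h3) _.
rewrite [leLHS](_ : _ = normc h ^+ 2 * s ^+ m.+1 * (m%:R ^+ 2 + m%:R)); last first.
  by rewrite (exprS s m); ring.
rewrite [leRHS](_ : _ = normc h ^+ 2 * s ^+ m.+1 * (m%:R ^+ 2 + m%:R + (m%:R + 1))); last first.
  by rewrite -(natr1 m); ring.
rewrite ler_wpM2l //; last by rewrite lerDl addr_ge0.
by rewrite mulr_ge0 // exprn_ge0 // normc_ge0.
Qed.

Lemma near0_punctured (d : R) : 0 < d ->
  \forall h \near (0 : C^o)^', h != 0 /\ normc h < d.
Proof.
move=> d0; have dC : 0 < d%:C by rewrite ltcR.
apply: filterS (filterI (dnbhs0_lt dC) (nbhs_dnbhs_neq (0 : C^o))) => h [h1 h2].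
by split=> //; move: h1; rewrite /= normc_norm ltcR.
Qed.

(** The difference quotient minus the candidate derivative is [h] times a series whose seminorm is
    bounded uniformly for |h| < 1; this is proved on partial sums and passed to the limit. *)
Lemma power_series_derive (b : nat -> H) (g g' : C -> H) :
  rapidly_decreasing b ->
  (forall z, series (fun m => z ^+ m *: b m) @ \oo --> g z) ->
  (forall z, series (fun m => z ^+ m *: (m.+1%:R *: b m.+1)) @ \oo --> g' z) ->
  forall z, is_cderive g z (g' z).
Proof.
move=> bR gE g'E z; apply/(cvg_semiP NP) => i e e0.
pose s := normc z + 1.
have s1 : 1 <= s by rewrite lerDr normc_ge0.
(* The factor 4 absorbs the m^2 of the Taylor remainder, as m^2 <= 4^m; the further 2 makes the
   series geometric. *)
have s0 : 0 < 4 * s by lra.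
have [K bK] := bR i (2 * (4 * s)) (mulr_gt0 (ltr0n _ 2) s0).
have K0 : 0 <= K.
  by apply: le_trans (bK 0%N); rewrite expr0 mul1r semi_ge0.
have K1 : 0 < 2 * K + 1 by lra.
(* The bound 1 keeps |h + z| <= s; adding 1 to 2 K avoids a division by zero. *)
have d0 : 0 < Num.min 1 (e / (2 * K + 1)) by rewrite lt_min ltr01 divr_gt0.
apply: filterS (near0_punctured d0) => h [h0]; rewrite lt_min => /andP[h1 he].
pose c m := (h ^+ 2)^-1 * ((h + z) ^+ m - z ^+ m - m%:R * h * z ^+ m.-1).
have cle m : normc (c m) <= (4 * s) ^+ m.
  rewrite Normc.normcM Normc.normcV normcX mulrC ler_pdivrMr; last first.
    by rewrite exprn_gt0 // normc_gt0.
  have zs : normc z <= s by rewrite lerDl.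
  have hs : normc (h + z) <= s.
    by apply: le_trans (normcD _ _) _; rewrite addrC lerD2l ltW.
  apply: le_trans (taylor_remainder_le m s1 zs hs) _.
  rewrite mulrC ler_wpM2r ?exprn_ge0 ?normc_ge0 // exprMn ler_wpM2r //.
    by rewrite exprn_ge0 //; lra.
  rewrite -!natrX ler_nat (_ : 4 = 2 ^ 2)%N // -expnM mulnC expnM.
  by rewrite leq_exp2r // ltnW // ltn_expl.
(* The original series are cut at [k.+1] and the differentiated one at [k], so that both stop at
   [b k]. *)
have lim : (fun k => h^-1 *: (series (fun m => (h + z) ^+ m *: b m) k.+1 +
      (-1) *: series (fun m => z ^+ m *: b m) k.+1) +
      (-1) *: series (fun m => z ^+ m *: (m.+1%:R *: b m.+1)) k) @ \oo -->
    h^-1 *: (g (h + z) + (-1) *: g z) + (-1) *: g' z.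
  have cS (u : nat -> H) (x : H) : (u @ \oo --> x) -> (fun k => u k.+1) @ \oo --> x.
    move=> ux V /ux[M _ MP]; exists M => // k /= Mk; apply: MP.
    exact: leqW.
  have c0 : (fun _ : nat => 0 : H) @ \oo --> (0 : H) by exact: cvg_cst.
  have cN (u : nat -> H) (x : H) : (u @ \oo --> x) -> (fun k => (-1) *: u k) @ \oo --> (-1) *: x.
    move=> ux; have := cvg_semi_linear (a := -1) ux c0; rewrite addr0.
    by apply: cvg_trans; apply: near_eq_cvg; apply: nearW => k; rewrite addr0.
  have cD (u v : nat -> H) (x y : H) : (u @ \oo --> x) -> (v @ \oo --> y) ->
      (fun k => u k + v k) @ \oo --> x + y.
    move=> ux vy; have := cvg_semi_linear (a := 1) ux vy; rewrite scale1r.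
    by apply: cvg_trans; apply: near_eq_cvg; apply: nearW => k; rewrite scale1r.
  apply: cvg_semi_linear; last exact: cN.
  by apply: cD; [exact: cS|apply: cN; exact: cS].
rewrite -(scaleN1r (g z)) -(scaleN1r (g' z)).
apply: (@le_lt_trans _ _ (normc h * (2 * K))); last first.
  apply: (@le_lt_trans _ _ (normc h * (2 * K + 1))).
    by rewrite ler_wpM2l ?normc_ge0 // lerDl.
  by rewrite -ltr_pdivlMr.
apply: (cvg_semi_le NP lim); apply: nearW => k.
have -> : h^-1 *: (series (fun m => (h + z) ^+ m *: b m) k.+1 +
      (-1) *: series (fun m => z ^+ m *: b m) k.+1) +
      (-1) *: series (fun m => z ^+ m *: (m.+1%:R *: b m.+1)) k =
    h *: \sum_(0 <= m < k.+1) c m *: b m.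
  have -> : series (fun m => z ^+ m *: (m.+1%:R *: b m.+1)) k =
      \sum_(0 <= m < k.+1) (m%:R * z ^+ m.-1) *: b m.
    rewrite /series /= big_nat_recl // mul0r scale0r add0r.
    by apply: eq_bigr => m _; rewrite scalerA mulrC.
  rewrite /series /= !scaler_sumr -big_split /= scaler_sumr -big_split /=.
  apply: eq_bigr => m _; rewrite !scalerA -scalerDl scalerA -scalerDl; congr (_ *: _).
  by rewrite /c; field.
apply: le_trans (semiZ NP _ _ _) _; rewrite ler_wpM2l ?normc_ge0 //.
have := @semi_sum_geometric i c b (4 * s) K 0 k.+1 K0 s0 cle bK.
by rewrite expr0 mulr1.
Qed.

Definition derive_coefs (b : nat -> H) m := m.+1%:R *: b m.+1.

(** Doubling the radius pays for the factor m + 1 <= 2^m; the shift of index costs one more power of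
    [2 * rho]. *)
Lemma rapidly_decreasing_derive b :
  rapidly_decreasing b -> rapidly_decreasing (derive_coefs b).
Proof.
move=> bR i rho rho0; have rho2 : 0 < 2 * rho by lra.
have [K bK] := bR i _ rho2; exists (K / (2 * rho)) => m.
rewrite ler_pdivlMr //; apply: le_trans (bK m.+1).
rewrite [leRHS](_ : _ = (2 * rho) ^+ m * N i (b m.+1) * (2 * rho)); last first.
  by rewrite (exprS _ m); ring.
rewrite ler_wpM2r ?(ltW rho2) // exprMn.
apply: (@le_trans _ _ (rho ^+ m * (m.+1%:R * N i (b m.+1)))).
  rewrite ler_wpM2l ?exprn_ge0 ?(ltW rho0) //; apply: le_trans (semiZ NP _ _ _) _.
  by rewrite -(rmorph_nat (real_complex R)) normc_real normr_nat.
rewrite mulrCA -mulrA ler_wpM2r //; last by rewrite -natrX ler_nat ltn_expl.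
by rewrite mulr_ge0 ?exprn_ge0 ?(semi_ge0 NP) // ltW.
Qed.

Lemma iter_derive_coefs k (b : nat -> H) m :
  iter k derive_coefs b m = ((m + k) ^_ k)%:R *: b (m + k)%N.
Proof.
elim: k m => [|k IH] m; first by rewrite addn0 ffactn0 scale1r.
rewrite iterS /derive_coefs IH scalerA -natrM addSnnS; congr (_%:R *: _).
by rewrite ffactnSr mulnC -addSnnS addnK.
Qed.

(** The k-th derivative is taken to be the sum of the k times formally differentiated series, whose
    value at 0 is its constant term k! b_k. *)
Lemma power_series_entire (f : C -> H) b : rapidly_decreasing b ->
  (forall z, series (fun m => z ^+ m *: b m) @ \oo --> f z) ->
  entire f /\ taylor_coefficients f b.
Proof.
move=> bR fE.
have bRk k : rapidly_decreasing (iter k derive_coefs b).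
  by elim: k => // k; exact: rapidly_decreasing_derive.
have ex (kz : nat * C) : exists l : H,
    series (fun m => kz.2 ^+ m *: iter kz.1 derive_coefs b m) @ \oo --> l.
  exact: power_series_cvg.
have [d dP] := choice ex.
have dE k z : is_cderive (fun z => d (k, z)) z (d (k.+1, z)).
  exact: (@power_series_derive _ (fun w => d (k, w)) (fun w => d (k.+1, w))
    (bRk k) (fun w => dP (k, w)) (fun w => dP (k.+1, w))).
have d0 : (fun z => d (0%N, z)) = f.
  by apply/funext => z; exact: (cvg_semi_unique Hhaus (dP (0%N, z)) (fE z)).
split=> [z|]; first by exists (d (1%N, z)); have := dE 0%N z; rewrite d0.
exists (fun k z => d (k, z)); split=> // k.
have -> : d (k, 0) = iter k derive_coefs b 0%N.
  apply: (cvg_semi_unique Hhaus (dP (k, 0))).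
  apply/(cvg_semiP NP) => i e e0; exists 1%N => // m /= m0.
  rewrite /series /= -(subnK m0) addn1 big_nat_recl // big1 => [|l _].
    by rewrite expr0 scale1r addr0 subrr (semi0 NP).
  by rewrite expr0n /= scale0r.
rewrite iter_derive_coefs add0n ffactnn scalerA mulVf ?scale1r //.
Qed.

End Analytic.

(** * Families of bilinear maps that are polynomial on a dense subset *)

Section Family.
Variables (R : realType) (H : tvsType R[i]) (I : Type) (N : I -> H -> R).
Local Notation C := R[i].
Hypothesis NP : generating_seminorms N.
Hypothesis Hhaus : hausdorff_space H.
Hypothesis Hcomp : forall F : set_system H, ProperFilter F -> tvs_cauchy F ->
  exists l : H, F --> l.

Lemma semiZE i a x : N i (a *: x) = normc a * N i x.
Proof.
apply/eqP; rewrite eq_le (semiZ NP) /=.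
have [->|a0] := eqVneq a 0.
  by rewrite Normc.normc0 mul0r scale0r (semi0 NP).
have an : 0 < normc a by rewrite normc_gt0.
have := semiZ NP i a^-1 (a *: x).
by rewrite scalerA mulVf // scale1r Normc.normcV -ler_pdivrMl ?invr_gt0 // invrK.
Qed.

(** Cauchy estimate on the unit circle: all nodes and weights have modulus 1, so the bound depends
    neither on m nor on the number of nodes. *)
Lemma semi_dft i n (w : C) (F : C -> H) m B : n.+1.-primitive_root w ->
  (forall z, normc z = 1 -> N i (F z) <= B) -> N i (dft n.+1 w F m) <= B.
Proof.
move=> wP FB; have w1 k : normc (w ^+ k) = 1 by rewrite normcX (normc_root wP) expr1n.
have nE : normc (n.+1%:R^-1 : C) = n.+1%:R^-1.
  by rewrite -(rmorph_nat (real_complex R)) -fmorphV normc_real ger0_norm.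
rewrite /dft semiZE nE mulrC ler_pdivrMr ?ltr0n //.
apply: le_trans (semi_sum NP _ _ _) _.
apply: (@le_trans _ _ (\sum_(i < n.+1) B)); last by rewrite sumr_const card_ord -(mulr_natr B).
apply: ler_sum => l _; rewrite semiZE Normc.normcV normcX w1 expr1n invr1 mul1r.
exact: FB.
Qed.

Variables (D : set H) (S : C -> H -> H -> H).
Hypothesis Dd : dense D.
Hypothesis Sc : forall z, continuous_bilinear (S z).
Hypothesis Spoly : forall P Q, D P -> D Q -> polynomial_map (fun z => S z P Q).
Hypothesis Scirc : forall i rho, 0 < rho -> exists i1 i2 K, 0 <= K /\
  forall z P Q, normc z = rho -> D P -> D Q ->
    N i (S z P Q) <= K * N i1 P * N i2 Q.

(** The approximants are chosen before [T], hence serve all bilinear maps with the same bound: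
    averages of every order, partial sums of every length and their limit. *)
Lemma bilinear_approx i i1 i2 K e P Q : 0 <= K -> 0 < e ->
  exists P' Q', [/\ D P', D Q' & forall T : H -> H -> H,
    (forall x, linear (T x)) -> (forall y, linear (T^~ y)) ->
    (forall x y, N i (T x y) <= K * N i1 x * N i2 y) ->
    N i (T P Q - T P' Q') < e].
Proof.
move=> K0 e0.
have small k (x : H) c : 0 <= c -> exists2 x', D x' & c * N k (x - x') < e / 2.
  move=> c0; have c1 : 0 < c + 1 by rewrite ltr_wpDl.
  have d0 : 0 < e / 2 / (c + 1) by rewrite !divr_gt0.
  have : nbhs x [set y | N k (y - x) < e / 2 / (c + 1)].
    by apply/(nbhs_semiP NP); exists k, (e / 2 / (c + 1)).
  move=> /(dense_nbhs Dd)[x' Dx' /= h]; exists x' => //.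
  rewrite (semi_distC NP); rewrite ltr_pdivlMr // in h.
  by apply: le_lt_trans h; rewrite mulrC ler_wpM2l ?(semi_ge0 NP) // lerDl.
(* [Q'] is chosen after [P'], because the error T P' (Q - Q') is weighted by the seminorm of
   [P']. *)
have [P' DP' hP] := small i1 P _ (mulr_ge0 K0 (semi_ge0 NP i2 Q)).
have [Q' DQ' hQ] := small i2 Q _ (mulr_ge0 K0 (semi_ge0 NP i1 P')).
exists P', Q'; split=> // T Tr Tl TK.
have -> : T P Q - T P' Q' = T (P - P') Q + T P' (Q - Q').
  have -> : T (P - P') Q = T P Q - T P' Q.
    by rewrite addrC -scaleN1r Tl scaleN1r addrC.
  have -> : T P' (Q - Q') = T P' Q - T P' Q'.
    by rewrite addrC -scaleN1r Tr scaleN1r addrC.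
  by rewrite addrA subrK.
apply: le_lt_trans (semiD NP _ _ _) _; rewrite (splitr e); apply: ltrD.
  by apply: le_lt_trans (TK _ _) _; rewrite mulrAC.
exact: le_lt_trans (TK _ _) _.
Qed.

Lemma circle_bound i rho : 0 < rho -> exists i1 i2 K, 0 <= K /\
  forall z P Q, normc z = rho -> N i (S z P Q) <= K * N i1 P * N i2 Q.
Proof.
move=> /(Scirc i)[i1 [i2 [K [K0 SK]]]]; exists i1, i2, K; split=> // z P Q zr.
by apply: (bilinear_bound_dense NP Dd (Sc z)) => P' Q'; exact: SK.
Qed.

Lemma dft_linearr n (w : C) m P : linear (fun Q => dft n w (fun z => S z P Q) m).
Proof.
move=> a Q Q'; rewrite /dft scalerA mulrC -scalerA -scalerDr; congr (_ *: _).
rewrite scaler_sumr -big_split; apply: eq_bigr => i _ /=.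
by have [h _ _] := Sc (w ^+ i); rewrite h scalerDr !scalerA mulrC.
Qed.

Lemma dft_linearl n (w : C) m Q : linear (fun P => dft n w (fun z => S z P Q) m).
Proof.
move=> a P P'; rewrite /dft scalerA mulrC -scalerA -scalerDr; congr (_ *: _).
rewrite scaler_sumr -big_split; apply: eq_bigr => i _ /=.
by have [_ h _] := Sc (w ^+ i); rewrite h scalerDr !scalerA mulrC.
Qed.

Lemma coefficient_extensions : exists Ck : nat -> H -> H -> H,
  [/\ forall m, continuous_bilinear (Ck m),
      forall P Q a M, D P -> D Q -> polynomial_with (fun z => S z P Q) a M ->
        forall m, Ck m P Q = a m &
      forall P Q, [/\ entire (fun z => S z P Q),
        taylor_coefficients (fun z => S z P Q) (fun m => Ck m P Q) &
        forall z, series (fun m => z ^+ m *: Ck m P Q) @ \oo --> S z P Q]].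
Proof.
have [w wP] := choice (fun n => @primitive_root_exists R n.+1 (ltn0Sn n)).
pose A m P Q n := dft n.+1 (w n) (fun z => S z P Q) m.
have A_ev P Q a M m n : polynomial_with (fun z => S z P Q) a M ->
    (M <= n)%N -> (m <= n)%N -> A m P Q n = a m.
  by move=> aP Mn mn; apply: (dft_polynomial (wP n) aP); rewrite ?ltnS // leqW.
have A_cvg (mPQ : nat * (H * H)) : exists l : H, A mPQ.1 mPQ.2.1 mPQ.2.2 @ \oo --> l.
  case: mPQ => m [P Q] /=; apply: (semi_complete NP Hcomp) => i e e0.
  have [i1 [i2 [K [K0 SK]]]] := circle_bound i ltr01.
  (* One pair approximates for all [n] simultaneously, and on that pair the averages are eventually
     constant, so the sequence for P and Q is Cauchy. *)
  have [P' [Q' [DP' DQ' h]]] := bilinear_approx i i1 i2 P Q K0 (divr_gt0 e0 (ltr0n _ 2)).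
  have [a [M aP]] := Spoly DP' DQ'.
  have AK n : N i (A m P Q n - A m P' Q' n) < e / 2.
    apply: (h (fun x y => A m x y n)) => [x|y|x y].
    - exact: dft_linearr.
    - exact: dft_linearl.
    - by apply: (semi_dft _ (wP n)) => z; exact: SK.
  exists (maxn M m) => n k; rewrite !geq_max => /andP[Mn mn] /andP[Mk mk].
  have -> : A m P Q n - A m P Q k =
      (A m P Q n - A m P' Q' n) - (A m P Q k - A m P' Q' k).
    rewrite (A_ev _ _ _ _ _ _ aP Mn mn) (A_ev _ _ _ _ _ _ aP Mk mk).
    by rewrite opprB addrA subrK.
  by apply: le_lt_trans (semiB NP _ _ _) _; rewrite (splitr e) ltrD.
have [Ck0 Ck0P] := choice A_cvg.
pose Ck m P Q := Ck0 (m, (P, Q)).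
have CkP m P Q : A m P Q @ \oo --> Ck m P Q := Ck0P (m, (P, Q)).
have CkD P Q a M : D P -> D Q -> polynomial_with (fun z => S z P Q) a M ->
    forall m, Ck m P Q = a m.
  move=> DP DQ aP m; apply: (cvg_semi_unique Hhaus (CkP m P Q)).
  apply/(cvg_semiP NP) => i e e0; exists (maxn M m) => // n /=.
  by rewrite geq_max => /andP[Mn mn]; rewrite (A_ev _ _ _ _ _ _ aP Mn mn) subrr (semi0 NP).
have Ckr m P : linear (Ck m P).
  move=> a Q Q'; apply: (cvg_semi_unique Hhaus (CkP m P _)).
  have := cvg_semi_linear NP (a := a) (CkP m P Q) (CkP m P Q').
  by apply: cvg_trans; apply: near_eq_cvg; apply: nearW => n; rewrite /A dft_linearr.
have Ckl m Q : linear (fun P => Ck m P Q).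
  move=> a P P'; apply: (cvg_semi_unique Hhaus (CkP m _ Q)).
  have := cvg_semi_linear NP (a := a) (CkP m P Q) (CkP m P' Q).
  by apply: cvg_trans; apply: near_eq_cvg; apply: nearW => n; rewrite /A dft_linearl.
(* The unit circle alone gives continuity, which the density argument for the other radii
   presupposes. *)
have Ckc m : continuous_bilinear (Ck m).
  apply: (bounded_bilinear_continuous NP); split=> // i.
  have [i1 [i2 [K [K0 SK]]]] := circle_bound i ltr01.
  exists i1, i2, K; split=> // P Q.
  apply: (cvg_semi_le NP (CkP m P Q)); apply: nearW => n.
  by apply: (semi_dft _ (wP n)) => z; exact: SK.
(* The Cauchy estimates, with seminorms and constant independent of m. *)
have Ckb i rho : 0 < rho -> exists i1 i2 K, 0 <= K /\
    forall m P Q, rho ^+ m * N i (Ck m P Q) <= K * N i1 P * N i2 Q.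
  move=> rho0; have [i1 [i2 [K [K0 SK]]]] := circle_bound i rho0.
  exists i1, i2, K; split=> // m P Q; have rm : 0 < rho ^+ m by rewrite exprn_gt0.
  rewrite mulrC -ler_pdivlMr // [leRHS](_ : _ = K / rho ^+ m * N i1 P * N i2 Q); last first.
    by field; rewrite gt_eqF.
  apply: (bilinear_bound_dense NP Dd (Ckc m)) => P' Q' DP' DQ'.
  have [a [M aP]] := Spoly DP' DQ'; rewrite (CkD _ _ _ _ DP' DQ' aP).
  rewrite [leRHS](_ : _ = K * N i1 P' * N i2 Q' / rho ^+ m); last first.
    by field; rewrite gt_eqF.
  rewrite ler_pdivlMr // mulrC.
  have rE : normc (rho%:C) = rho by rewrite normc_real gtr0_norm.
  (* Substituting rho z for z moves the circle of radius rho to the unit circle and multiplies the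
     m-th coefficient by rho^m. *)
  have aP' : polynomial_with (fun z => S (rho%:C * z) P' Q') (fun m => rho%:C ^+ m *: a m) M.
    have [a0 SE] := aP; split=> [k /a0 ->|z]; first by rewrite scaler0.
    by rewrite SE; apply: eq_bigr => k _; rewrite scalerA exprMn mulrC.
  have -> : rho ^+ m * N i (a m) = N i (rho%:C ^+ m *: a m).
    by rewrite semiZE normcX rE.
  pose n := maxn M m.
  rewrite -(@dft_polynomial _ _ n.+1 (w n) _ _ M m (wP n) aP') ?ltnS ?leq_maxr //; last first.
    by rewrite leqW // leq_maxl.
  by apply: (semi_dft _ (wP n)) => z z1; apply: SK; rewrite Normc.normcM z1 rE mulr1.
have Sser P Q z : series (fun m => z ^+ m *: Ck m P Q) @ \oo --> S z P Q.
  apply/(cvg_semiP NP) => i e e0; pose s := normc z + 1.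
  have s0 : 0 < s by rewrite ltr_wpDl // normc_ge0.
  have [i1 [i2 [K [K0 CK]]]] := Ckb i (2 * s) (mulr_gt0 (ltr0n _ 2) s0).
  pose T M x y := series (fun m => z ^+ m *: Ck m x y) M.
  have K20 : 0 <= 2 * K by rewrite mulr_ge0.
  have TK M x y : N i (T M x y) <= 2 * K * N i1 x * N i2 y.
    have := @semi_sum_geometric _ _ _ _ NP i (fun m => z ^+ m) (fun m => Ck m x y) s
      (K * N i1 x * N i2 y) 0 M.
    rewrite expr0 mulr1 !mulrA; apply=> //; first by rewrite !mulr_ge0 ?(semi_ge0 NP).
    by move=> l; rewrite normcX lerXn2r ?nnegrE ?normc_ge0 ?lerDl // ltW.
  have Tr M x : linear (T M x).
    move=> a y y'; rewrite /T /series /= scaler_sumr -big_split; apply: eq_bigr => m _ /=.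
    by rewrite Ckr scalerDr !scalerA mulrC.
  have Tl M y : linear (fun x => T M x y).
    move=> a x x'; rewrite /T /series /= scaler_sumr -big_split; apply: eq_bigr => m _ /=.
    by rewrite Ckl scalerDr !scalerA mulrC.
  have TD x y : D x -> D y -> exists M0, forall M, (M0 <= M)%N -> T M x y = S z x y.
    move=> Dx Dy; have [a [M0 aP]] := Spoly Dx Dy; exists M0 => M M0M.
    have [_ ->] := polynomial_with_widen M0M aP.
    rewrite /T /series /= big_mkord; apply: eq_bigr => m _.
    by rewrite (CkD _ _ _ _ Dx Dy aP).
  (* [S z] must obey the same bound as the partial sums for one pair of approximants to serve both;
     on [D] it equals a partial sum. *)
  have SK x y : N i (S z x y) <= 2 * K * N i1 x * N i2 y.
    apply: (bilinear_bound_dense NP Dd (Sc z)) => x' y' Dx' Dy'.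
    by have [M0 /(_ M0 (leqnn _)) <-] := TD _ _ Dx' Dy'.
  have e2 : 0 < e / 2 by rewrite divr_gt0.
  have [P' [Q' [DP' DQ' h]]] := bilinear_approx i i1 i2 P Q K20 e2.
  have [M0 MP] := TD _ _ DP' DQ'; exists M0 => // M /= /MP TS.
  rewrite -/(T M P Q).
  have -> : T M P Q - S z P Q = (T M P Q - T M P' Q') - (S z P Q - S z P' Q').
    by rewrite TS opprB addrA subrK.
  apply: le_lt_trans (semiB NP _ _ _) _; rewrite (splitr e) ltrD //.
    by apply: (h (T M)).
  by have [Sr Sl _] := Sc z; apply: (h (S z)).
exists Ck; split=> // P Q.
have rap : rapidly_decreasing N (fun m => Ck m P Q).
  move=> i rho /(Ckb i)[i1 [i2 [K [K0 CK]]]].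
  by exists (K * N i1 P * N i2 Q) => m; exact: CK.
by have [] := power_series_entire NP Hhaus Hcomp rap (Sser P Q).
Qed.

End Family.

(** * Extension of the seminorms to the completion *)

Section Completion.
Variables (R : realType) (n : nat) (G : topGroupType) (A : set (chart R n G)).
Variables (X : 'I_n -> (G -> R) -> (G -> R)) (r r' : R).
Variables (H : tvsType R[i]) (j : (G -> symalg R n) -> H).
Local Notation C := R[i].
Local Notation Sym := (symalg R n).
Local Notation Pol := (Pol A X r).
Local Notation pol_norm := (pol_norm A X r r').
Hypothesis jP : is_completion A X r r' j.

Lemma j_linear a P Q : Pol P -> Pol Q -> j (a *: P + Q) = a *: j P + j Q.
Proof. by case: jP => _ h _ _ _; exact: h. Qed.

Lemma j0 : j 0 = 0.
Proof.
have := j_linear 1 (Pol0 A X r) (Pol0 A X r).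
by rewrite scaler0 addr0 scale1r => h; apply: (@addrI _ (j 0)); rewrite addr0 -h.
Qed.

Lemma jD P Q : Pol P -> Pol Q -> j (P + Q) = j P + j Q.
Proof. by move=> hP hQ; have := j_linear 1 hP hQ; rewrite !scale1r. Qed.

Lemma jZ a P : Pol P -> j (a *: P) = a *: j P.
Proof.
by move=> hP; have := j_linear a hP (Pol0 A X r); rewrite !addr0 j0 addr0.
Qed.

Lemma jB P Q : Pol P -> Pol Q -> j (P - Q) = j P - j Q.
Proof.
by move=> hP hQ; rewrite -scaleN1r (jD hP (PolZ (-1) hQ)) (jZ _ hQ) scaleN1r.
Qed.

Definition polball (c c' t : R) : set H := j @` [set P | Pol P /\ pol_norm c c' P < t].

(** The gauge of the closed balls in [H]. Taking closures extends [pol_norm] without choosing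
    approximating nets. *)
Definition hnorm (c c' : R) (h : H) : R := inf [set t | closure (polball c c' t) h].

Lemma addH_continuous (x y : H) : continuous_at (x, y) (fun p : H * H => p.1 + p.2).
Proof. exact: add_continuous. Qed.

Lemma scaleH_continuous a : continuous ( *:%R a : H -> H).
Proof.
move=> x; apply: (@continuous_comp _ _ _ (fun x => (a : C^o, x)) (fun p : C^o * H => p.1 *: p.2)).
  by apply: (@cvg_pair _ _ _ _ (nbhs (a : C^o))); [exact: cvg_cst|exact: cvg_id].
exact: scale_continuous.
Qed.

Lemma subr_continuous (x : H) : continuous (fun y => x - y).
Proof.
move=> y; apply: (@continuous_comp _ _ _ (fun y => (x, y)) (fun p : H * H => p.1 - p.2)).
  by apply: cvg_pair; [exact: cvg_cst|exact: cvg_id].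
exact: sub_continuous.
Qed.

Lemma Pol_dense (x : H) V : nbhs x V -> exists2 P, Pol P & V (j P).
Proof.
by case: jP => _ _ _ _ jd /(dense_nbhs jd)[_ [P PP <-]]; exists P.
Qed.

Section FixedWeights.
Variables (c c' : R) (c0 : 0 <= c) (c'0 : 0 <= c').
Local Notation ball := (polball c c').

(** Only the polynomials in a neighborhood of 0 are known to have small norm; by density they
    accumulate at every point of its interior. *)
Lemma closure_ball_nbhs e : 0 < e -> nbhs 0 (closure (ball e)).
Proof.
case: jP => _ _ _ jn _ e0; have [V Vn VP] := jn c c' e c0 c'0 e0.
move: Vn; rewrite nbhsE => -[W [oW W0] WV].
exists W; first by split.
move=> x Wx B Bx.
have [P PP [BP WP]] := Pol_dense (filterI Bx (open_nbhs_nbhs (conj oW Wx))).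
by exists (j P); split=> //; exists P => //; split=> //; apply/VP/WV.
Qed.

Lemma closure_ballD s t x y : closure (ball s) x -> closure (ball t) y ->
  closure (ball (s + t)) (x + y).
Proof.
move=> xs yt B /(addH_continuous)[[B1 B2] [/= /xs[_ [[P [PP Ps] <-] BP]] /yt[_ [[Q [QQ Qt] <-] BQ]]]] BB.
exists (j (P + Q)); split; last by rewrite jD //; exact: (BB (j P, j Q)).
exists (P + Q) => //; split; first exact: PolD.
by apply: le_lt_trans (pol_normD_le _ _ _ _ _) _ => //; exact: ltrD.
Qed.

Lemma closure_ballZ a t x : a != 0 -> closure (ball t) x ->
  closure (ball (normc a * t)) (a *: x).
Proof.
move=> a0 xt B /(scaleH_continuous)/xt[_ [[P [PP Pt] <-] BP]].
exists (j (a *: P)); split; last by rewrite jZ.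
exists (a *: P) => //; split; first exact: PolZ.
by apply: le_lt_trans (pol_normZ_le _ _ _ _ _) _ => //; rewrite ltr_pM2l ?normc_gt0.
Qed.

Lemma ball_gt0 t x : closure (ball t) x -> 0 < t.
Proof.
move=> /(_ setT filterT)[_ [[P [PP Pt] _] _]].
exact: le_lt_trans (pol_norm_ge0 _ _ _ _ _ _ _) Pt.
Qed.

Lemma hnorm_le t x : closure (ball t) x -> hnorm c c' x <= t.
Proof. by move=> xt; apply: ge_inf => //; exists 0 => s /ball_gt0/ltW. Qed.

Lemma hnorm_lt t : 0 < t -> nbhs 0 [set x | hnorm c c' x < t].
Proof.
move=> t0; apply: filterS (closure_ball_nbhs (divr_gt0 t0 (ltr0n _ 2))) => y /hnorm_le h.
by apply: le_lt_trans h _; lra.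
Qed.

Lemma in_ball P : Pol P -> closure (ball (pol_norm c c' P + 1)) (j P).
Proof. by move=> PP; apply: subset_closure; exists P => //; split=> //; lra. Qed.

Lemma hnorm_nonempty x : [set t | closure (ball t) x] !=set0.
Proof.
have : nbhs x [set y | closure (ball 1) (x - y)].
  have := @subr_continuous x x (closure (ball 1)); rewrite /= subrr; apply.
  exact: closure_ball_nbhs.
move=> /Pol_dense[P PP h]; exists (1 + (pol_norm c c' P + 1)) => /=.
by rewrite -(subrK (j P) x); apply: closure_ballD => //; exact: in_ball.
Qed.

Lemma hnorm_ge0 x : 0 <= hnorm c c' x.
Proof. by apply: inf_ge0 => t /ball_gt0/ltW. Qed.

Lemma hnormD x y : hnorm c c' (x + y) <= hnorm c c' x + hnorm c c' y.
Proof.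
apply: inf_le_add; [exact: hnorm_nonempty|exact: hnorm_nonempty| |].
  by move=> t /ball_gt0/ltW.
by move=> s t xs yt; exists (s + t) => //; exact: closure_ballD.
Qed.

Lemma hnormZ a x : hnorm c c' (a *: x) <= normc a * hnorm c c' x.
Proof.
have [->|a0] := eqVneq a 0.
  rewrite scale0r Normc.normc0 mul0r; apply/ler_addgt0Pl => e e0; rewrite addr0.
  by apply: hnorm_le; apply: nbhs_singleton; exact: closure_ball_nbhs.
apply: (inf_le_scale (normc_ge0 a)); first exact: hnorm_nonempty.
  by move=> t /ball_gt0/ltW.
by move=> t xt; exists (normc a * t) => //; exact: closure_ballZ.
Qed.

(** Taking closures does not lower the norm: a polynomial [Q] near [P] in [H] is near it in
    [pol_norm], since the topology of polynomials is the induced one. *)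
Lemma hnorm_j P : Pol P -> hnorm c c' (j P) = pol_norm c c' P.
Proof.
move=> PP; apply/eqP; rewrite eq_le; apply/andP; split.
  apply/ler_addgt0Pr => e e0; apply: hnorm_le; apply: subset_closure.
  by exists P => //; split=> //; rewrite ltrDl.
apply: lb_le_inf; first exact: hnorm_nonempty.
move=> t Pt; apply/ler_addgt0Pl => e e0.
case: (jP) => _ _ _ jn _; have [V Vn VP] := jn c c' e c0 c'0 e0.
have : nbhs (j P) [set y | V (j P - y)].
  by have := @subr_continuous (j P) (j P) V; rewrite /= subrr; exact.
move=> /Pt[_ [[Q [QQ Qt] <-] VQ]].
have PQ : Pol (P - Q) by rewrite -scaleN1r; apply: PolD => //; exact: PolZ.
have {}VQ : pol_norm c c' (P - Q) < e by apply: VP => //; rewrite jB.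
rewrite -(subrK Q P); apply: le_trans (pol_normD_le _ _ _ _ _) _ => //.
by apply: lerD; exact: ltW.
Qed.

End FixedWeights.

(** Nonnegativity is built into the index type, because the record of seminorms quantifies over all
    indices. *)
Definition weights := {cc : R * R | (0 <= cc.1) && (0 <= cc.2)}.

Definition hseminorm (w : weights) : H -> R := hnorm (sval w).1 (sval w).2.

Lemma weights_ge0 (w : weights) : 0 <= (sval w).1 /\ 0 <= (sval w).2.
Proof. by apply/andP; exact: svalP w. Qed.

Lemma hseminorm_generating : generating_seminorms hseminorm.
Proof.
split.
- by move=> w x; have [? ?] := weights_ge0 w; exact: hnorm_ge0.
- by move=> w x y; have [? ?] := weights_ge0 w; exact: hnormD.
- by move=> w a x; have [? ?] := weights_ge0 w; exact: hnormZ.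
- by move=> w e e0; have [? ?] := weights_ge0 w; exact: hnorm_lt.
move=> V Vn; have [W Wn WV] := @uniform_regular H 0 V Vn.
case: (jP) => _ _ jt _ _; have [c [c' [e [c0 c'0 e0 hW]]]] := jt W Wn.
have cc : (0 <= c) && (0 <= c') by rewrite c0.
exists (exist _ (c, c') cc), e; split=> // x xe; apply: WV.
have [t xt te] := inf_lt (hnorm_nonempty c0 c'0 x) xe.
move=> B /xt[_ [[P [PP Pt] <-] BP]]; exists (j P); split=> //.
by apply: hW => //; exact: lt_trans te.
Qed.

End Completion.

(** * The standard-ordered star product *)

Section StandardOrdered.
Variables (R : realType) (n : nat) (G : topGroupType) (A : set (chart R n G)).
Variables (X : 'I_n -> (G -> R) -> (G -> R)) (U : algType R[i]) (u : 'I_n -> U).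
Variables (q : R[i] -> {linear symalg R n -> U}).
Variables (gutt : R[i] -> symalg R n -> symalg R n -> symalg R n).
Variables (r r' : R) (H : tvsType R[i]) (j : (G -> symalg R n) -> H).
Variable star : R[i] -> H -> H -> H.
Local Notation C := R[i].
Local Notation Sym := (symalg R n).
Local Notation Pol := (Pol A X r).
Local Notation entire_functions := (entire_functions A X r).
Hypothesis Xb : left_invariant_basis A X.
Hypothesis uP : is_enveloping A X u.
Hypothesis qP : is_quantization u q.
Hypothesis guttP : is_gutt q gutt.
Hypothesis jP : is_completion A X r r' j.
Hypothesis starP : forall hbar, is_std_star A X gutt r j hbar (star hbar).

Lemma enveloping_brackets i l : exists zeta : 'rV[R]_n,
  u i * u l - u l * u i = lin_ext u zeta.
Proof.
have [zeta hz] := basis_brackets Xb i l.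
by exists zeta; case: uP => /(_ _ _ _ hz) <- _; rewrite !lin_ext_delta.
Qed.

Lemma polynomial_tens (phi : G -> C) (F : C -> Sym) :
  polynomial_map F -> polynomial_map (fun z => tens phi (F z)).
Proof.
move=> [b [N [_ FE]]].
apply: (@eq_polynomial _ _ (fun z => \sum_(m < N) z ^+ m *: tens phi (b m))).
  move=> z; apply/funext => g; rewrite fct_sumE /tens FE scaler_sumr.
  apply: eq_bigr => m _.
  by rewrite [LHS](_ : _ = z ^+ m *: (phi g *: b m)) // !scalerA mulrC.
by apply: polynomial_sum => m; exact: polynomial_monomial.
Qed.

Lemma std_formula_polynomial phi k (xi : 'I_k -> 'rV[R]_n) psi eta :
  polynomial_map (std_formula X gutt phi xi psi eta).
Proof.
pose f p (sg : 'S_k) x := phi x * lie_derivs X (take p (map xi (codom sg))) psi x.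
pose v p (sg : 'S_k) : Sym := \prod_(x <- drop p (map xi (codom sg))) sym_of x.
apply: (@eq_polynomial _ _ (fun z => \sum_(p < k.+1) \sum_(sg : 'S_k)
    ('i^-1 ^+ p / (p`! * (k - p)`!)%:R * z ^+ p) *:
      tens (f p sg) (gutt ('i^-1 * z) (v p sg) eta))).
  move=> z; apply/funext => g; rewrite fct_sumE; apply: eq_bigr => p _.
  rewrite fct_sumE; apply: eq_bigr => sg _.
  have -> : z / 'i = 'i^-1 * z by rewrite mulrC.
  by rewrite [in RHS]exprMn mulrAC.
apply: polynomial_sum => p; apply: polynomial_sum => sg; apply: polynomial_powZ.
apply: polynomial_tens; apply: (@polynomial_compZ _ _ 'i^-1 (fun z => gutt z _ eta)).
exact: (gutt_polynomial qP guttP enveloping_brackets).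
Qed.

(** Each coefficient is a linear combination of values at roots of unity, so it lies where the
    values lie; no closure of the entire functions under products and Lie derivatives has to be
    shown. *)
Lemma Pol_coefficients (F : C -> G -> Sym) a N : polynomial_with F a N ->
  (forall z, Pol (F z)) -> forall m, Pol (a m).
Proof.
move=> aP FP m; have [w wP] := @primitive_root_exists R (maxn N m).+1 (ltn0Sn _).
rewrite -(dft_polynomial (m := m) wP aP) ?ltnS ?leq_maxr //; last first.
  by rewrite leqW // leq_maxl.
by apply/PolZ/Pol_sum => i; exact: PolZ.
Qed.

Lemma j_sum (I : Type) (e : seq I) (F : I -> G -> Sym) :
  (forall i, Pol (F i)) -> j (\sum_(i <- e) F i) = \sum_(i <- e) j (F i).
Proof.
move=> FP; elim: e => [|i e IH]; first by rewrite !big_nil (j0 jP).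
by rewrite !big_cons (jD jP) // ?IH //; exact: Pol_sum.
Qed.

Lemma star_polynomial_with phi k (xi : 'I_k -> 'rV[R]_n) psi eta a N :
  entire_functions phi -> entire_functions psi ->
  polynomial_with (std_formula X gutt phi xi psi eta) a N ->
  polynomial_with (fun z => star z (j (tens phi (\prod_(i < k) sym_of (xi i))))
    (j (tens psi eta))) (fun m => j (a m)) N.
Proof.
move=> phie psie aP.
have FP z : Pol (std_formula X gutt phi xi psi eta z).
  by have [_ /(_ phi psi k xi eta phie psie)[]] := starP z.
have aPol := Pol_coefficients aP FP; have [a0 FE] := aP.
split=> [m /a0 ->|z]; first exact: j0 jP.
have [_ /(_ phi psi k xi eta phie psie)[_ ->]] := starP z.
rewrite FE j_sum => [|m]; last exact: PolZ.
by apply: eq_bigr => m _; rewrite (jZ jP).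
Qed.

Lemma star_linearr z P : linear (star z P).
Proof. by have [[h _ _] _] := starP z; exact: h. Qed.

Lemma star_linearl z Q : linear (star z ^~ Q).
Proof. by have [[_ h _] _] := starP z; exact: h. Qed.

Lemma star0r z P : star z P 0 = 0.
Proof.
have := star_linearr z P 1 0 0; rewrite scaler0 scale1r addr0 => h.
by apply: (@addrI _ (star z P 0)); rewrite addr0 -h.
Qed.

Lemma star0l z Q : star z 0 Q = 0.
Proof.
have := star_linearl z Q 1 0 0; rewrite scaler0 scale1r addr0 => h.
by apply: (@addrI _ (star z 0 Q)); rewrite addr0 -h.
Qed.

Lemma starZ z a b P Q : star z (a *: P) (b *: Q) = (a * b) *: star z P Q.
Proof.
have := star_linearl z (b *: Q) a P 0; rewrite !addr0 star0l addr0 => ->.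
have := star_linearr z P b Q 0; rewrite !addr0 star0r addr0 => ->.
by rewrite scalerA.
Qed.

Lemma star_polynomial P Q : Pol P -> Pol Q ->
  polynomial_map (fun z => star z (j P) (j Q)).
Proof.
move=> PP QQ; move: P PP; apply: Pol_ind.
- by apply: eq_polynomial (polynomial0 _) => z; rewrite (j0 jP) star0l.
- move=> a P P' PP PP' h h'.
  apply: eq_polynomial (polynomialD (polynomial_powZ 0 a h) h') => z.
  by rewrite (j_linear jP) // star_linearl expr0 mulr1.
move=> phi s phie; move: Q QQ; apply: Pol_ind.
- by apply: eq_polynomial (polynomial0 _) => z; rewrite (j0 jP) star0r.
- move=> a P P' PP PP' h h'.
  apply: eq_polynomial (polynomialD (polynomial_powZ 0 a h) h') => z.
  by rewrite (j_linear jP) // star_linearr expr0 mulr1.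
move=> psi t psie; rewrite smon_sym_of.
have [a [N aP]] := std_formula_polynomial phi
  (fun i => delta_mx 0 (tnth (in_tuple s) i)) psi (smon t).
by eexists; exists N; exact: star_polynomial_with aP.
Qed.

(** * Homogeneity of the star product and bounds on circles *)

Definition dil (a : C) (P : G -> Sym) : G -> Sym := fun g => dilate a (P g).

Lemma dilP a b P Q : dil a (b *: P + Q) = b *: dil a P + dil a Q.
Proof. by apply/funext => g; rewrite /dil linearP. Qed.

Lemma dil_homog a d phi (v : Sym) : v \is ishomog1 d mdeg ->
  dil a (tens phi v) = a ^+ d *: tens phi v.
Proof.
move=> vd; apply/funext => g; rewrite /dil /tens linearZ /= (dilate_homog _ vd).
by rewrite scalerA mulrC -scalerA.
Qed.

Lemma Pol_dil a P : Pol P -> Pol (dil a P).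
Proof.
move=> /(Pol_dilate 1 a); congr (Pol _).
by apply/funext => g; rewrite scale1r.
Qed.

Lemma pol_norm_dil_le c c' a P : 0 <= c -> 0 <= c' -> Pol P ->
  pol_norm A X r r' c c' (dil a P) <= pol_norm A X r r' c (normc a * c') P.
Proof.
move=> c0 c'0 PP; have := pol_norm_dilate_le r' 1 a c0 c'0 PP.
rewrite Normc.normc1 mul1r; congr (pol_norm _ _ _ _ _ _ _ <= _).
by apply/funext => g; rewrite scale1r.
Qed.

(* The star product is homogeneous: its term of order p in hbar lowers the
   polynomial degree by p. *)
Lemma std_formula_dil z phi (s t : seq 'I_n) psi
    (xi := fun i => delta_mx 0 (tnth (in_tuple s) i) : 'rV[R]_n) : z != 0 ->
  std_formula X gutt phi xi psi (smon t) z =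
  dil z^-1 (z ^+ (size s + size t) *: std_formula X gutt phi xi psi (smon t) 1).
Proof.
move=> z0; apply/funext => g.
rewrite /dil [(_ *: _) g]/(_ *: _) linearZ /= /std_formula.
rewrite (linear_sum (dilate z^-1)) scaler_sumr; apply: eq_bigr => p _.
rewrite (linear_sum (dilate z^-1)) scaler_sumr; apply: eq_bigr => sg _.
have dZ a (v : Sym) : dilate z^-1 (a *: v) = a *: dilate z^-1 v by rewrite linearZ.
rewrite /tens /= !dZ.
set v := \prod_(x <- _) _.
have i0 : 1 / 'i != 0 :> C by rewrite div1r invr_eq0 -complexiE neq0Ci.
have vh : v \is ishomog1 (size s - p) mdeg.
  have := prod_sym_of_homog (drop p (map xi (codom sg))).
  by rewrite size_drop size_map size_codom card_ord.
have -> : z / 'i = z * (1 / 'i) :> C by rewrite div1r.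
rewrite (gutt_dilate qP guttP z0 i0 vh (smon_homog _ t)) !scalerA.
congr (_ *: _).
have ps : (p <= size s)%N by rewrite -ltnS.
(* In the term of order p, hbar^p supplies z^p and the Gutt product of degrees k - p and l supplies
   the rest, so the total power k + l is independent of p. *)
have -> : z ^+ (size s + size t) = z ^+ p * z ^+ (size s - p + size t).
  by rewrite -exprD addnA subnKC.
by rewrite (exprMn p z); ring.
Qed.

(** Dilations are not defined on [H], so the product at parameter 1 is first represented by a
    polynomial [P'], which can then be dilated back. *)
Lemma star_dil z P Q : z != 0 -> Pol P -> Pol Q -> exists P',
  [/\ Pol P', star 1 (j (dil z P)) (j (dil z Q)) = j P' &
      star z (j P) (j Q) = j (dil z^-1 P')].
Proof.
move=> z0 PP QQ.
have dil0 a : dil a 0 = 0 by apply/funext => g; rewrite /dil linear0.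
move: P PP; apply: Pol_ind.
- exists 0; split; first exact: Pol0.
    by rewrite dil0 (j0 jP) star0l.
  by rewrite dil0 (j0 jP) star0l.
- move=> a P1 P2 PP1 PP2 [P1' [h1 e1 f1]] [P2' [h2 e2 f2]].
  exists (a *: P1' + P2'); split.
  + by apply: PolD => //; exact: PolZ.
  + by rewrite dilP !(j_linear jP) ?star_linearl ?e1 ?e2 //; exact: Pol_dil.
  + by rewrite dilP !(j_linear jP) ?star_linearl ?f1 ?f2 //; exact: Pol_dil.
move=> phi s phie; move: Q QQ; apply: Pol_ind.
- exists 0; split; first exact: Pol0.
    by rewrite dil0 (j0 jP) star0r.
  by rewrite dil0 (j0 jP) star0r.
- move=> a P1 P2 PP1 PP2 [P1' [h1 e1 f1]] [P2' [h2 e2 f2]].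
  exists (a *: P1' + P2'); split.
  + by apply: PolD => //; exact: PolZ.
  + by rewrite dilP !(j_linear jP) ?star_linearr ?e1 ?e2 //; exact: Pol_dil.
  + by rewrite dilP !(j_linear jP) ?star_linearr ?f1 ?f2 //; exact: Pol_dil.
move=> psi t psie; pose xi i : 'rV[R]_n := delta_mx 0 (tnth (in_tuple s) i).
have [_ /(_ phi psi _ xi (smon t) phie psie)[h1 e1]] := starP 1.
have [_ /(_ phi psi _ xi (smon t) phie psie)[hz ez]] := starP z.
exists (z ^+ (size s + size t) *: std_formula X gutt phi xi psi (smon t) 1); split.
- exact: PolZ.
- rewrite !(dil_homog _ _ (smon_homog _ _)) !(jZ jP) //; try exact: Pol_tens.
  by rewrite starZ -exprD {1}smon_sym_of e1.
- by rewrite {1}smon_sym_of ez (std_formula_dil _ _ _ _ z0).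
Qed.

Definition rescale (t : R) (t0 : 0 <= t) (w : weights R) : weights R :=
  exist _ ((sval w).1, t * (sval w).2)
    (introT andP (conj (weights_ge0 w).1 (mulr_ge0 t0 (weights_ge0 w).2))).

Lemma hseminorm_dil_le (w : weights R) (t : R) (t0 : 0 <= t) z P :
  normc z = t -> Pol P ->
  hseminorm A X r r' j w (j (dil z P)) <=
  hseminorm A X r r' j (rescale t0 w) (j P).
Proof.
move=> zt PP; have [c0 c'0] := weights_ge0 w.
rewrite /hseminorm !(hnorm_j jP) //=; last 2 first.
- by rewrite mulr_ge0.
- exact: Pol_dil.
by rewrite -zt; exact: pol_norm_dil_le.
Qed.

(** The weights change only through the modulus of z, so seminorms and constant are common to the
    circle. *)
Lemma star_circle_bound (w : weights R) rho : 0 < rho ->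
  exists w1 w2 : weights R, exists K, 0 <= K /\
    forall z P Q, normc z = rho -> (j @` Pol) P -> (j @` Pol) Q ->
    hseminorm A X r r' j w (star z P Q) <=
    K * hseminorm A X r r' j w1 P * hseminorm A X r r' j w2 Q.
Proof.
move=> rho0; have rho1 : 0 <= rho := ltW rho0.
have rhoV : 0 <= rho^-1 by rewrite invr_ge0.
have NP := hseminorm_generating jP; have [S1 _] := starP 1.
(* The outer dilation by z^-1 replaces [w] by its rescaling with rho^-1, so the bound for [star 1]
   is requested for that seminorm. *)
have [_ _ /(_ (rescale rhoV w))[w1 [w2 [K [K0 SK]]]]] := continuous_bilinear_bounded NP S1.
exists (rescale rho1 w1), (rescale rho1 w2), K; split=> // z _ _ zr [P PP <-] [Q QQ <-].
have z0 : z != 0 by rewrite -normc_gt0 zr.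
have zV : normc z^-1 = rho^-1 by rewrite Normc.normcV zr.
have [P' [PP' e1 ->]] := star_dil z0 PP QQ.
apply: le_trans (hseminorm_dil_le w rhoV zV PP') _; rewrite -e1.
apply: le_trans (SK _ _) _.
have h1 := hseminorm_dil_le w1 rho1 zr PP; have h2 := hseminorm_dil_le w2 rho1 zr QQ.
apply: ler_pM h2 => //; [|exact: semi_ge0 NP _ _|by rewrite ler_wpM2l].
by rewrite mulr_ge0 // (semi_ge0 NP).
Qed.

Lemma star_entire_with_coefficients :
  exists2 B : nat -> (G -> C) -> forall k : nat, ('I_k -> 'rV[R]_n) ->
                (G -> C) -> Sym -> (G -> Sym),
    (forall phi psi k (xi : 'I_k -> 'rV[R]_n) eta,
       entire_functions phi -> entire_functions psi ->
       has_coefficients (std_formula X gutt phi xi psi eta)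
         (fun m => B m phi k xi psi eta)) &
  exists2 Ck : nat -> H -> H -> H,
    (forall m, is_extension A X r j (B m) (Ck m)) &
    forall P Q : H,
      [/\ entire (fun hbar => star hbar P Q),
          taylor_coefficients (fun hbar => star hbar P Q)
            (fun m => Ck m P Q) &
          forall hbar : C,
            series (fun m => hbar ^+ m *: Ck m P Q) @ \oo --> star hbar P Q].
Proof.
have [[Hhaus Hcomp] _ _ _ jd] := jP.
(* Polynomiality in hbar is algebraic and holds for arbitrary functions phi and psi, so [B] can be
   chosen for all arguments at once. *)
pose pol phi k xi psi eta := cid (@std_formula_polynomial phi k xi psi eta).
pose B (m : nat) phi k xi psi eta := sval (pol phi k xi psi eta) m.
have BP phi k xi psi eta : exists N, polynomial_with
    (std_formula X gutt phi xi psi eta) (fun m => B m phi k xi psi eta) N.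
  exact: (svalP (pol phi k xi psi eta)).
have Sc z : continuous_bilinear (star z) by have [] := starP z.
have Spoly P Q : (j @` Pol) P -> (j @` Pol) Q -> polynomial_map (fun z => star z P Q).
  by move=> [P' PP <-] [Q' QQ <-]; exact: star_polynomial.
have [Ck [Ckc CkD CkE]] := coefficient_extensions (hseminorm_generating jP)
  Hhaus Hcomp jd Sc Spoly star_circle_bound.
exists B.
  move=> phi psi k xi eta _ _; have [N [B0 BE]] := BP phi k xi psi eta.
  by exists N; split=> // z g; rewrite BE fct_sumE.
exists Ck => // m; split=> // phi psi k xi eta phie psie.
have [N aP] := BP phi k xi psi eta; split.
  apply: (Pol_coefficients aP) => z.
  by have [_ /(_ phi psi k xi eta phie psie)[]] := starP z.
apply: (CkD _ _ (fun m => j (B m phi k xi psi eta)) N).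
- by exists (tens phi (\prod_(i < k) sym_of (xi i))) => //; exact: Pol_tens.
- by exists (tens psi eta) => //; exact: Pol_tens.
- exact: star_polynomial_with.
Qed.

End StandardOrdered.

Theorem theorem6p4 (R : realType) (n : nat) (G : topGroupType)
    (A : set (chart R n G)) (X : 'I_n -> (G -> R) -> (G -> R))
    (U : algType R[i]) (u : 'I_n -> U)
    (q : R[i] -> {linear symalg R n -> U})
    (gutt : R[i] -> symalg R n -> symalg R n -> symalg R n)
    (r r' : R)
    (H : tvsType R[i]) (j : (G -> symalg R n) -> H)
    (star : R[i] -> H -> H -> H) :
  lie_group_atlas A -> connected [set: G] ->
  left_invariant_basis A X ->
  is_enveloping A X u -> is_quantization u q -> is_gutt q gutt ->
  0 <= r -> 1 <= r' ->
  is_completion A X r r' j ->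
  (forall hbar, is_std_star A X gutt r j hbar (star hbar)) ->
  exists2 B : nat -> (G -> R[i]) -> forall k : nat, ('I_k -> 'rV[R]_n) ->
                (G -> R[i]) -> symalg R n -> (G -> symalg R n),
    (forall phi psi k (xi : 'I_k -> 'rV[R]_n) eta,
       entire_functions A X r phi -> entire_functions A X r psi ->
       has_coefficients (std_formula X gutt phi xi psi eta)
         (fun m => B m phi k xi psi eta)) &
  exists2 Ck : nat -> H -> H -> H,
    (forall m, is_extension A X r j (B m) (Ck m)) &
    forall P Q : H,
      [/\ entire (fun hbar => star hbar P Q),
          taylor_coefficients (fun hbar => star hbar P Q)
            (fun m => Ck m P Q) &
          forall hbar : R[i],
            series (fun m => hbar ^+ m *: Ck m P Q) @ \oo --> star hbar P Q].
Proof.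
move=> _ _ Xb uP qP guttP _ _ jP starP.
exact: (star_entire_with_coefficients Xb uP qP guttP jP starP).
Qed.
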